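(* Let $(M,g)$ be an $m$-dimensional oriented Riemannian manifold and let $(v_1,\dots,v_m)$ be a positively oriented orthonormal basis for $T_{x_0}M$, $x_0\in M$. Given functions $\kappa_j\in C^\infty(t_0-\delta,t_0+\delta)$, $0\le j\le m-1$, with $\kappa_j>0$ for $0\le j\le m-2$, there exist $0<\varepsilon\le\delta$ and a unique Frenet curve $\sigma\colon(t_0-\varepsilon,t_0+\varepsilon)\to M$ such that (i) $\sigma(t_0)=x_0$; (ii) $X_j^\sigma(t_0)=v_j$ for $1\le j\le m$; (iii) $\kappa_j^\sigma=\kappa_j$ for $0\le j\le m-1$.
   Context: Let $\nabla$ be the Levi-Civita connection of $g$ and $T^\sigma$ the tangent field of a smooth curve $\sigma\colon(a,b)\to M$. The curve $\sigma$ is a Frenet curve if $T^\sigma,\nabla_{T^\sigma}T^\sigma,\dots,\nabla_{T^\sigma}^{m-2}T^\sigma$ are linearly independent at every $t\in(a,b)$. For a Frenet curve in an oriented Riemannian manifold there are unique vector fields $X_1^\sigma,\dots,X_m^\sigma$ along $\sigma$ (the Frenet frame) and smooth functions $\kappa_0^\sigma,\dots,\kappa_{m-1}^\sigma\colon(a,b)\to\mathbb{R}$ (the curvatures), with $\kappa_j^\sigma>0$ for $0\le j\le m-2$, such that: (i) $(X_1^\sigma(t),\dots,X_m^\sigma(t))$ is a positively oriented orthonormal frame for all $t$; (ii) for $1\le i\le m-1$ the systems $(X_1^\sigma,\dots,X_i^\sigma)$ and $(T^\sigma,\dots,\nabla_{T^\sigma}^{i-1}T^\sigma)$ span the same subspace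 and are equally oriented at every $t$; (iii) $T^\sigma=\kappa_0^\sigma X_1^\sigma$, $\nabla_{X_1^\sigma}X_1^\sigma=\kappa_1^\sigma X_2^\sigma$, $\nabla_{X_1^\sigma}X_i^\sigma=-\kappa_{i-1}^\sigma X_{i-1}^\sigma+\kappa_i^\sigma X_{i+1}^\sigma$ for $2\le i\le m-1$, and $\nabla_{X_1^\sigma}X_m^\sigma=-\kappa_{m-1}^\sigma X_{m-1}^\sigma$. *)

(* Defs.v *)
From HB Require Import structures.
From mathcomp Require Import all_boot all_order all_algebra.
From mathcomp Require Import all_classical all_reals all_analysis.
Set Implicit Arguments.
Unset Strict Implicit.
Unset Printing Implicit Defensive.
Import Order.TTheory GRing.Theory Num.Theory.
Import numFieldNormedType.Exports.
Local Open Scope classical_set_scope.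
Local Open Scope ring_scope.

(* Iterated directional derivative 'D_v1 ('D_v2 (... f)), s = [:: v1; v2; ...] *)
Definition iterD (R : realType) (V W : normedModType R) (s : seq V)
    (f : V -> W) : V -> W :=
  foldr (fun v h => 'D_v h) f s.

(* C^oo on an open set U: all iterated derivatives are (Frechet)
   differentiable, hence continuous, at every point of U.  Only the values of f
   on the open set U matter. *)
Definition smooth_on (R : realType) (V W : normedModType R) (U : set V)
    (f : V -> W) : Prop :=
  forall (s : seq V) (x : V), U x -> differentiable (iterD s f) x.

(* An m-dimensional smooth manifold given by a smooth atlas (charts and their
   inverses are total functions, used only on [chart_dom i] and on its image),
   with a preferred chart [chart_at x] around each point x. *)
Record smooth_manifold (R : realType) (m : nat) := SmoothManifold {
  mpoint :> topologicalType;
  mhausdorff : hausdorff_space mpoint;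
  msecond_countable : @second_countable mpoint;
  chart_index : Type;
  chart_dom : chart_index -> set mpoint;
  chart : chart_index -> mpoint -> 'rV[R]_m;
  chart_inv : chart_index -> 'rV[R]_m -> mpoint;
  chart_at : mpoint -> chart_index;
  chart_dom_open : forall i, open (chart_dom i);
  chart_image_open : forall i, open (chart i @` chart_dom i);
  chartK : forall i x, chart_dom i x -> chart_inv i (chart i x) = x;
  chart_continuous : forall i x, chart_dom i x ->
    {for x, continuous (chart i)};
  chart_inv_continuous : forall i y, (chart i @` chart_dom i) y ->
    {for y, continuous (chart_inv i)};
  transition_smooth : forall i j,
    smooth_on (chart i @` (chart_dom i `&` chart_dom j))
              (chart j \o chart_inv i);
  chart_at_dom : forall x, chart_dom (chart_at x) x }.

(* The tangent space T_x M is 'rV[R]_m: a tangent vector v at x is encoded by the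
   row of its components in the preferred chart [chart_at x]; its components in
   another chart i around x are [tcomp i x v]. *)
Section Manifold.
Context {R : realType} {m : nat} (M : smooth_manifold R m).
Implicit Types (x : M) (i j : chart_index M).

(* Jacobian at x of the change of chart from i to j (acting on row vectors on
   the right). *)
Definition transition_jac i j x : 'M[R]_m :=
  jacobian (chart j \o chart_inv i) (chart i x).

Definition tcomp i x (v : 'rV[R]_m) : 'rV[R]_m :=
  v *m transition_jac (chart_at x) i x.

(* The coordinate vector field d/dx^k of the chart i, at x. *)
Definition coord_field i (k : 'I_m) x : 'rV[R]_m :=
  delta_mx 0 k *m transition_jac i (chart_at x) x.

(* An orientation of M, given by an oriented atlas. *)
Definition oriented_atlas : Prop :=
  forall i j x, chart_dom i x -> chart_dom j x -> 0 < \det (transition_jac i j x).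

(* For an oriented atlas, the sign of this determinant of components in the
   preferred chart at x is the same in every chart around x. *)
Definition pos_oriented x (v : 'I_m -> 'rV[R]_m) : Prop :=
  0 < \det (\matrix_(k < m) v k).

Definition smooth_fun (U : set M) (f : M -> R) : Prop :=
  forall i, smooth_on (chart i @` (chart_dom i `&` U)) (f \o chart_inv i).

(* Vector fields are functions Y with Y x in T_x M. *)
Definition smooth_vfield (U : set M) (Y : M -> 'rV[R]_m) : Prop :=
  forall i, smooth_on (chart i @` (chart_dom i `&` U))
    (fun y => tcomp i (chart_inv i y) (Y (chart_inv i y))).

(* df_x(v) *)
Definition dfun (f : M -> R) x (v : 'rV[R]_m) : R :=
  'D_v (f \o chart_inv (chart_at x)) (chart (chart_at x) x).

(* [X, Y]^k = X^a d_a Y^k - Y^a d_a X^k in the chart [chart_at x] *)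
Definition lie_bracket (X Y : M -> 'rV[R]_m) x : 'rV[R]_m :=
  let c := chart_at x in
  let loc (Z : M -> 'rV[R]_m) := fun y => tcomp c (chart_inv c y) (Z (chart_inv c y)) in
  'D_(X x) (loc Y) (chart c x) - 'D_(Y x) (loc X) (chart c x).

Record riemannian_metric (g : M -> 'rV[R]_m -> 'rV[R]_m -> R) : Prop := {
  metric_linear : forall x w, scalar (fun v => g x v w);
  metric_sym : forall x v w, g x v w = g x w v;
  metric_pos : forall x v, v != 0 -> 0 < g x v v;
  metric_smooth : forall i (a b : 'I_m),
    smooth_fun (chart_dom i) (fun x => g x (coord_field i a x) (coord_field i b x)) }.

Definition orthonormal_basis (g : M -> 'rV[R]_m -> 'rV[R]_m -> R) x
    (v : 'I_m -> 'rV[R]_m) : Prop :=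
  forall a b, g x (v a) (v b) = (a == b)%:R.

(* An affine connection: [nabla x v Y] is nabla_v Y for v in T_x M and Y a vector
   field defined and smooth in a neighbourhood of x (connections being local
   operators, they act on locally defined fields). *)
Record affine_connection
    (nabla : forall x : M, 'rV[R]_m -> (M -> 'rV[R]_m) -> 'rV[R]_m) : Prop := {
  nabla_linear : forall U Y x a u v, open U -> smooth_vfield U Y -> U x ->
    nabla x (a *: u + v) Y = a *: nabla x u Y + nabla x v Y;
  nabla_add : forall U Y Z x v, open U ->
    smooth_vfield U Y -> smooth_vfield U Z -> U x ->
    nabla x v (fun z => Y z + Z z) = nabla x v Y + nabla x v Z;
  nabla_leibniz : forall U f Y x v, open U ->
    smooth_fun U f -> smooth_vfield U Y -> U x ->
    nabla x v (fun z => f z *: Y z) = dfun f x v *: Y x + f x *: nabla x v Y;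
  nabla_smooth : forall U X Y, open U -> smooth_vfield U X -> smooth_vfield U Y ->
    smooth_vfield U (fun x => nabla x (X x) Y) }.

Record levi_civita (g : M -> 'rV[R]_m -> 'rV[R]_m -> R)
    (nabla : forall x : M, 'rV[R]_m -> (M -> 'rV[R]_m) -> 'rV[R]_m) : Prop := {
  levi_civita_connection : affine_connection nabla;
  levi_civita_torsion_free : forall U X Y x, open U ->
    smooth_vfield U X -> smooth_vfield U Y -> U x ->
    nabla x (X x) Y - nabla x (Y x) X = lie_bracket X Y x;
  levi_civita_metric : forall U Y Z x v, open U ->
    smooth_vfield U Y -> smooth_vfield U Z -> U x ->
    dfun (fun z => g z (Y z) (Z z)) x v =
      g x (nabla x v Y) (Z x) + g x (Y x) (nabla x v Z) }.

End Manifold.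

(* Curves (a,b) -> M, and fields along them, are total functions on R of which
   only the values on (a,b) matter. *)
Section Curves.
Context {R : realType} {m : nat} (M : smooth_manifold R m).
Variable nabla : forall x : M, 'rV[R]_m -> (M -> 'rV[R]_m) -> 'rV[R]_m.
Implicit Types (sigma : R -> M) (X : R -> 'rV[R]_m).

Definition smooth_curve (a b : R) sigma : Prop :=
  (forall t, a < t < b -> {for t, continuous sigma}) /\
  forall i, smooth_on [set t | a < t < b /\ chart_dom i (sigma t)]
                      (chart i \o sigma).

(* A smooth vector field along sigma: X t in T_(sigma t) M. *)
Definition smooth_along (a b : R) sigma X : Prop :=
  forall i, smooth_on [set t | a < t < b /\ chart_dom i (sigma t)]
                      (fun t => tcomp i (sigma t) (X t)).

Definition velocity sigma (t : R) : 'rV[R]_m :=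
  derive1 (chart (chart_at (sigma t)) \o sigma) t.

(* Covariant derivative along sigma: if X = sum_k X^k d_k in the chart c, then
   nabla_T X = sum_k ((X^k)' d_k + X^k nabla_T d_k). *)
Definition covD sigma X (t : R) : 'rV[R]_m :=
  let c := chart_at (sigma t) in
  let Xc (k : 'I_m) (s : R) : R := tcomp c (sigma s) (X s) 0 k in
  \sum_(k < m) (derive1 (Xc k) t *: coord_field c k (sigma t)
                + Xc k t *: nabla (sigma t) (velocity sigma t) (coord_field c k)).

Definition velocityD sigma (k : nat) : R -> 'rV[R]_m :=
  iter k (covD sigma) (velocity sigma).

Definition frenet_curve (a b : R) sigma : Prop :=
  smooth_curve a b sigma /\
  forall t, a < t < b ->
    row_free (\matrix_(k < m.-1) velocityD sigma k t).

(* Two systems of n independent vectors of the same subspace (the rows of A and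
   of B) are equally oriented. *)
Definition equally_oriented n (A B : 'M[R]_(n, m)) : Prop :=
  exists2 P : 'M[R]_n, A = P *m B & 0 < \det P.

(* X 1, ..., X m is the Frenet frame of sigma and kappa 0, ..., kappa (m - 1)
   are its curvatures; X 0 and the terms of higher index are unused.  As
   T = kappa_0 X_1, the derivative nabla_(X_1) is kappa_0^-1 nabla_T. *)
Record frenet_apparatus (g : M -> 'rV[R]_m -> 'rV[R]_m -> R) (a b : R) sigma
    (X : nat -> R -> 'rV[R]_m) (kappa : nat -> R -> R) : Prop := {
  frenet_frame_smooth : forall j, (1 <= j <= m)%N ->
    smooth_along a b sigma (X j);
  frenet_curvature_smooth : forall j, (j <= m - 1)%N ->
    smooth_on [set t : R | a < t < b] (kappa j);
  frenet_curvature_pos : forall j t, (j <= m - 2)%N -> a < t < b ->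
    0 < kappa j t;
  frenet_orthonormal : forall t, a < t < b ->
    orthonormal_basis g (sigma t) (fun k : 'I_m => X k.+1 t) /\
    pos_oriented (sigma t) (fun k : 'I_m => X k.+1 t);
  frenet_span : forall i t, (1 <= i <= m - 1)%N -> a < t < b ->
    let A := \matrix_(k < i) X k.+1 t in
    let B := \matrix_(k < i) velocityD sigma k t in
    (A == B)%MS /\ equally_oriented A B;
  frenet_velocity : forall t, a < t < b ->
    velocity sigma t = kappa 0%N t *: X 1%N t;
  frenet_first : forall t, a < t < b ->
    (kappa 0%N t)^-1 *: covD sigma (X 1%N) t = kappa 1%N t *: X 2%N t;
  frenet_middle : forall i t, (2 <= i <= m - 1)%N -> a < t < b ->
    (kappa 0%N t)^-1 *: covD sigma (X i) t =
      - kappa (i - 1)%N t *: X (i - 1)%N t + kappa i t *: X (i + 1)%N t;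
  frenet_last : forall t, a < t < b ->
    (kappa 0%N t)^-1 *: covD sigma (X m) t =
      - kappa (m - 1)%N t *: X (m - 1)%N t }.

End Curves.

(* Main.v *)
Require Import Defs.
From HB Require Import structures.
From mathcomp Require Import all_boot all_order all_algebra.
From mathcomp Require Import all_classical all_reals all_analysis.
From mathcomp Require Import ring lra zify.
Import Order.TTheory GRing.Theory Num.Theory.
Import numFieldNormedType.Exports.
Local Open Scope classical_set_scope.
Local Open Scope ring_scope.

(* In a chart, a curve together with m fields along it satisfies the Frenet
   equations with curvatures kappa_j exactly when its coordinates solve a first
   order system of ODEs whose right-hand side is smooth: it is polynomial in the
   frame, with coefficients given by the kappa_j and the Christoffel symbols.
   Picard iteration produces a local solution starting at (x_0, v_1, ..., v_m),
   and a bootstrap argument makes it smooth.  By metric compatibility the Gram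
   matrix of the frame solves a linear ODE which, the Frenet matrix being
   skew-symmetric, also has the identity as a solution, so that the frame stays
   orthonormal; its orientation persists by continuity.  The iterated derivatives
   of the velocity are triangular in the frame, with positive diagonal, whence
   the Frenet property.  For uniqueness, local uniqueness for the ODE, in a
   chart around any point where two solutions agree, makes the set of agreement
   open; it is also closed, and intervals are connected. *)

Set Implicit Arguments.
Unset Strict Implicit.
Unset Printing Implicit Defensive.

(** * Smooth functions *)

(** Tangent vectors are rows of components in the preferred chart at their base point, and this
    chart may jump along a curve. A field along a curve therefore need not be continuous as a
    row-valued function, and [covD] is written in a chart that varies with t. Every argument is
    moved to a chart fixed near the instant considered, which is possible once the covariant
    derivative is known not to depend on the chart. The axioms of a connection concern fields on
    open subsets of M, and a field along a curve need not extend to one. The product rules along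
    curves are thus recovered from the coordinate fields and the components in them. The unknown of
    the differential equation is a finite family of real functions, and distances are replaced by
    common bounds on the coordinates. The interval shrinks twice: so that a solution exists and
    stays in one chart, and again because orthonormality comes from a uniqueness statement valid
    only near t_0, and orientation from continuity there. The last curvature may have any sign
    because the derivatives of the velocity matter only up to order m - 2, where the leading
    coefficients involve the positive curvatures alone. *)

Lemma near_eq_differentiable {R : realType} {V W : normedModType R}
    (f g : V -> W) (x : V) :
  (\near x, f x = g x) -> differentiable f x -> differentiable g x.
Proof.
move=> fg df; pose e := g - f.
have e0 : \near x, e x = 0.
  by apply: filterS fg => y fgy; rewrite [LHS](_ : _ = g y - f y)// fgy subrr.
(* Since [e] vanishes near [x], its first order expansion holds there with zero linear part. *)
have eo : e \o shift x = cst (e x) + (\0 : V -> W) +o_ 0 id.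
  apply/eqaddoP => _/posnumP[eps]; near=> h.
  rewrite /= [X in `|X|](_ : _ = e (h + x) - (e x + 0)) //.
  rewrite (nbhs_singleton e0) addr0 subr0.
  have -> : e (h + x) = 0.
    near: h; have hx : h + x @[h --> (0 : V)] --> x.
      by rewrite -[X in _ --> X]add0r; apply: cvgD => //; apply: cvg_cst.
    exact: hx e0.
  by rewrite normr0 mulr_ge0.
have de : differentiable e x.
  apply/diff_locallyP.
  have dE := diff_unique (df := \0) (fun y => cvg_cst 0) eo.
  by rewrite dE; split => // y; apply: cvg_cst.
have -> : g = f + e by apply/funext => y; rewrite /e !fctE addrC subrK.
exact: differentiableD.
Unshelve. all: by end_near. Qed.

Lemma differentiable_mxP {R : realType} {V : normedModType R} {p q : nat}
    (f : V -> 'M[R]_(p, q)) (x : V) :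
  differentiable f x <-> forall i j, differentiable (fun y => f y i j) x.
Proof.
split=> [df i j|df].
  have dc := differentiable_coord (f x) i j.
  exact: (differentiable_comp df dc).
have -> : f = \sum_(i < p) \sum_(j < q) (fun y => f y i j *: delta_mx i j).
  apply/funext => y; rewrite [LHS]matrix_sum_delta fct_sumE.
  by apply: eq_bigr => i _; rewrite fct_sumE.
apply: differentiable_sum => i; apply: differentiable_sum => j.
exact: differentiableZl.
Qed.

Lemma derive_coord {R : realType} {V : normedModType R} {p q : nat}
    (f : V -> 'M[R]_(p, q)) (x v : V) i j :
  differentiable f x -> ('D_v f x) i j = 'D_v (fun y => f y i j) x.
Proof. by move=> df; rewrite derive_mx ?mxE//; exact: diff_derivable. Qed.

Lemma derive_comp {R : realType} {U V W : normedModType R}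
    (f : U -> V) (g : V -> W) (x v : U) :
  differentiable f x -> differentiable g (f x) ->
  'D_v (g \o f) x = 'D_('D_v f x) g (f x).
Proof.
move=> df dg; rewrite deriveE; last exact: differentiable_comp.
by rewrite diff_comp//= -!deriveE.
Qed.

Lemma derive_row {R : realType} {W : normedModType R} {p : nat}
    (g : 'rV[R]_p -> W) (y v : 'rV[R]_p) :
  differentiable g y -> 'D_v g y = \sum_(k < p) v 0 k *: 'D_(delta_mx 0 k) g y.
Proof.
move=> dg; rewrite {1}[v]row_sum_delta deriveE // linear_sum.
by apply: eq_bigr => k _; rewrite linearZ /= deriveE.
Qed.

Section CnOn.
Context {R : realType}.

(** The finite order version of [smooth_on]: derivatives up to order [n] are differentiable on [U].
    Product and chain rules involve a function together with its derivatives, so closure properties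
    are proved by induction on the order and transferred to [smooth_on] by [smooth_onP]. *)
Fixpoint cn_on {V W : normedModType R} (n : nat) (U : set V) (f : V -> W)
    {struct n} : Prop :=
  (forall x, U x -> differentiable f x) /\
  if n is k.+1 then forall v, cn_on k U ('D_v f) else True.

Section Basics.
Context {V W : normedModType R}.
Implicit Types (U : set V) (f g : V -> W).

Lemma cn_onS n U f : cn_on n.+1 U f -> cn_on n U f.
Proof.
elim: n f => [|n IH] f [df Df]; split => // v; exact: IH (Df v).
Qed.

(** In [iterD] the derivative taken first is along the last vector of the list, so lists are
    decomposed from the right. *)
Lemma smooth_onP U f : smooth_on U f <-> forall n, cn_on n U f.
Proof.
split=> [sf n|cf s x Ux].
  elim: n f sf => [|n IH] f sf; (split; first by move=> x /(sf [::])) => // v.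
  by apply: IH => s x Ux; have := sf (rcons s v) x Ux; rewrite /Defs.iterD foldr_rcons.
have := cf (size s); clear cf; elim/last_ind: s f => [|s v IH] f cf.
  exact: cf.1.
rewrite /Defs.iterD foldr_rcons; apply: IH; rewrite size_rcons in cf.
exact: cf.2.
Qed.

Lemma near_open_eq U f g x : open U -> {in U, f =1 g} -> U x ->
  \near x, f x = g x.
Proof.
move=> oU fg Ux; near=> y; apply: fg; rewrite inE; near: y.
exact: open_nbhs_nbhs.
Unshelve. all: by end_near. Qed.

Lemma eq_cn_on n U f g : open U -> {in U, f =1 g} -> cn_on n U f -> cn_on n U g.
Proof.
move=> oU; elim: n f g => [|n IH] f g fg [df Df]; split=> //.
- move=> x Ux; apply: near_eq_differentiable (df _ Ux).
  exact: near_open_eq oU fg Ux.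
- move=> x Ux; apply: near_eq_differentiable (df _ Ux).
  exact: near_open_eq oU fg Ux.
- move=> v; apply: IH (Df v) => x; rewrite inE => Ux.
  apply: near_eq_derive; exact: near_open_eq oU fg Ux.
Qed.

Lemma eq_smooth_on U f g :
  open U -> {in U, f =1 g} -> smooth_on U f -> smooth_on U g.
Proof.
move=> oU fg /smooth_onP sf; apply/smooth_onP => n.
exact: eq_cn_on oU fg (sf n).
Qed.

Lemma smooth_on_subset U U' f : U `<=` U' -> smooth_on U' f -> smooth_on U f.
Proof. by move=> sU sf s x Ux; apply: sf; exact: sU. Qed.

Lemma smooth_on_differentiable U f x : smooth_on U f -> U x -> differentiable f x.
Proof. by move=> /(_ [::] x). Qed.

Lemma smooth_on_derive U f v : smooth_on U f -> smooth_on U ('D_v f).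
Proof.
move=> sf s x Ux; have := sf (rcons s v) x Ux.
by rewrite /Defs.iterD foldr_rcons.
Qed.

Lemma cn_on_cst n U (a : W) : cn_on n U (cst a).
Proof.
elim: n a => [|n IH] a; (split; first by move=> *; exact: differentiable_cst) => // v.
have -> : 'D_v (cst a) = cst (0 : W) by apply/funext => x; exact: derive_cst.
exact: IH.
Qed.

Lemma cn_onD n U f g : open U -> cn_on n U f -> cn_on n U g ->
  cn_on n U (fun x => f x + g x).
Proof.
move=> oU; elim: n f g => [|n IH] f g [df Df] [dg Dg]; split => //.
- by move=> x Ux; apply: differentiableD; [exact: df|exact: dg].
- by move=> x Ux; apply: differentiableD; [exact: df|exact: dg].
move=> v; apply: eq_cn_on (IH _ _ (Df v) (Dg v)) => // x; rewrite inE => Ux.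
by apply/esym/deriveD; apply: diff_derivable; [exact: df|exact: dg].
Qed.

End Basics.

Lemma cn_on_sum {V W : normedModType R} n (U : set V) (I : Type) (r : seq I)
    (P : pred I) (F : I -> V -> W) : open U ->
  (forall i, P i -> cn_on n U (F i)) ->
  cn_on n U (fun x => \sum_(i <- r | P i) F i x).
Proof.
move=> oU cF; elim: r => [|i r IH].
  have -> : (fun x => \sum_(j <- [::] | P j) F j x) = cst 0.
    by apply/funext => x; rewrite big_nil.
  exact: cn_on_cst.
have -> : (fun x => \sum_(j <- i :: r | P j) F j x) = fun x =>
    if P i then F i x + \sum_(j <- r | P j) F j x else \sum_(j <- r | P j) F j x.
  by apply/funext => x; rewrite big_cons.
case: (boolP (P i)) => // Pi.
by apply: cn_onD => //; exact: cF.
Qed.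

Lemma cn_onM {V : normedModType R} n (U : set V) (f g : V -> R) : open U ->
  cn_on n U f -> cn_on n U g -> cn_on n U (fun x => f x * g x).
Proof.
move=> oU; elim: n f g => [|n IH] f g cf cg; split => //.
- by move=> x Ux; apply: differentiableM; [exact: cf.1|exact: cg.1].
- by move=> x Ux; apply: differentiableM; [exact: cf.1|exact: cg.1].
move=> v; apply: (@eq_cn_on _ _ _ _ (fun x => f x * 'D_v g x + g x * 'D_v f x)) => //.
  move=> x; rewrite inE => Ux; apply/esym.
  by apply: deriveM; apply: diff_derivable; [exact: cf.1|exact: cg.1].
apply: cn_onD => //; apply: IH;
  by [exact: cn_onS | exact: cf.2 | exact: cg.2].
Qed.

Lemma cn_on_mxP {V : normedModType R} {p q} n (U : set V)
    (f : V -> 'M[R]_(p, q)) : open U ->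
  cn_on n U f <-> forall i j, cn_on n U (fun x => f x i j).
Proof.
move=> oU; elim: n f => [|n IH] f.
  split=> [[df _] i j|df].
    by split=> // x /df /differentiable_mxP.
  by split=> // x Ux; apply/differentiable_mxP => i j; exact: (df i j).1.
split=> [[df Df] i j|df].
  split=> [x /df /differentiable_mxP//|v].
  apply: eq_cn_on ((IH _).1 (Df v) i j) => // x; rewrite inE => Ux.
  by rewrite derive_coord//; exact: df.
have Df x : U x -> differentiable f x.
  by move=> Ux; apply/differentiable_mxP => i j; exact: (df i j).1.
split=> // v; apply/IH => i j.
apply: eq_cn_on ((df i j).2 v) => // x; rewrite inE => Ux.
by rewrite derive_coord//; exact: Df.
Qed.

(** By the chain rule, a derivative of the composite is a sum of products of components of ['D_v f]
    with partial derivatives of [g] composed with the same [f]. The induction therefore keeps [f]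
    fixed and generalizes over [g]. *)
Lemma cn_on_comp {V : normedModType R} {p : nat} n (U : set V)
    (U' : set 'rV[R]_p) (f : V -> 'rV[R]_p) (g : 'rV[R]_p -> R) : open U ->
  (forall x, U x -> U' (f x)) -> cn_on n U f -> cn_on n U' g ->
  cn_on n U (fun x => g (f x)).
Proof.
move=> oU UU'; elim: n g => [|n IH] g cf cg.
  split => // x Ux; apply: (differentiable_comp (cf.1 _ Ux)).
  by apply: cg.1; exact: UU'.
split=> [x Ux|v].
  by apply: (differentiable_comp (cf.1 _ Ux)); apply: cg.1; exact: UU'.
apply: (@eq_cn_on _ _ _ _
  (fun x => \sum_(k < p) ('D_v f x) 0 k * 'D_(delta_mx 0 k) g (f x))) => //.
  move=> x; rewrite inE => Ux.
  have df := cf.1 _ Ux; have dg := cg.1 _ (UU' _ Ux).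
  by rewrite [RHS](derive_comp _ df dg) (derive_row _ dg).
apply: cn_on_sum => // k _; apply: cn_onM => //.
  exact: ((cn_on_mxP _ _ oU).1 (cf.2 v)).
by apply: (IH ('D_(delta_mx 0 k) g)); [exact: cn_onS | exact: cg.2].
Qed.

Lemma smooth_on_cst {V W : normedModType R} (U : set V) (a : W) :
  smooth_on U (fun _ => a).
Proof. by apply/smooth_onP => n; exact: cn_on_cst. Qed.

Lemma smooth_onD {V W : normedModType R} (U : set V) (f g : V -> W) : open U ->
  smooth_on U f -> smooth_on U g -> smooth_on U (fun x => f x + g x).
Proof.
by move=> oU /smooth_onP sf /smooth_onP sg; apply/smooth_onP => n; exact: cn_onD.
Qed.

Lemma smooth_onM {V : normedModType R} (U : set V) (f g : V -> R) : open U ->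
  smooth_on U f -> smooth_on U g -> smooth_on U (fun x => f x * g x).
Proof.
by move=> oU /smooth_onP sf /smooth_onP sg; apply/smooth_onP => n; exact: cn_onM.
Qed.

Lemma smooth_on_sum {V W : normedModType R} (U : set V) (I : Type) (r : seq I)
    (P : pred I) (F : I -> V -> W) : open U ->
  (forall i, P i -> smooth_on U (F i)) ->
  smooth_on U (fun x => \sum_(i <- r | P i) F i x).
Proof.
move=> oU sF; apply/smooth_onP => n; apply: cn_on_sum => // i Pi.
exact: ((smooth_onP _ _).1 (sF i Pi)).
Qed.

Lemma smooth_on_mxP {V : normedModType R} {p q} (U : set V)
    (f : V -> 'M[R]_(p, q)) : open U ->
  smooth_on U f <-> forall i j, smooth_on U (fun x => f x i j).
Proof.
move=> oU; split=> [/smooth_onP sf i j|sf].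
  by apply/smooth_onP => n; exact: ((cn_on_mxP _ _ oU).1 (sf n)).
apply/smooth_onP => n; apply/cn_on_mxP => // i j.
exact: ((smooth_onP _ _).1 (sf i j)).
Qed.

Lemma smooth_on_comp {V : normedModType R} {p q r : nat} (U : set V)
    (U' : set 'rV[R]_p) (f : V -> 'rV[R]_p) (g : 'rV[R]_p -> 'M[R]_(q, r)) :
  open U -> open U' -> (forall x, U x -> U' (f x)) ->
  smooth_on U f -> smooth_on U' g -> smooth_on U (fun x => g (f x)).
Proof.
move=> oU oU' UU' sf sg; apply/smooth_on_mxP => // i j; apply/smooth_onP => n.
apply: (@cn_on_comp _ _ _ _ U' f (fun y => g y i j)) => //.
  exact: ((smooth_onP _ _).1 sf).
by apply/(smooth_onP _ _).1; apply: ((smooth_on_mxP _ oU').1 sg).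
Qed.

Lemma smooth_on_comp_scalar {V : normedModType R} {p : nat} (U : set V)
    (U' : set 'rV[R]_p) (f : V -> 'rV[R]_p) (g : 'rV[R]_p -> R) :
  open U -> open U' -> (forall x, U x -> U' (f x)) ->
  smooth_on U f -> smooth_on U' g -> smooth_on U (fun x => g (f x)).
Proof.
move=> oU oU' UU' sf sg; apply/smooth_onP => n.
by apply: (@cn_on_comp _ _ _ _ U' f g) => //; apply/(smooth_onP _ _).1.
Qed.

Lemma smooth_on_mulmx {V : normedModType R} {p q r : nat} (U : set V)
    (A : V -> 'M[R]_(p, q)) (B : V -> 'M[R]_(q, r)) : open U ->
  smooth_on U A -> smooth_on U B -> smooth_on U (fun x => A x *m B x).
Proof.
move=> oU sA sB; apply/smooth_on_mxP => // i j.
have -> : (fun x => (A x *m B x) i j) = fun x => \sum_k A x i k * B x k j.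
  by apply/funext => x; rewrite mxE.
apply: smooth_on_sum => // k _.
by apply: smooth_onM => //; apply: (smooth_on_mxP _ oU).1.
Qed.

End CnOn.

(** * Ordinary differential equations *)

Section RealLemmas.
Context {R : realType}.
Implicit Types (f df : R -> R).

Lemma le_of_halving (x y C : R) : (forall n, x <= y + C / 2 ^+ n) -> x <= y.
Proof.
move=> h; apply/ler_addgt0Pr => e e0.
have [n Cn] : exists n : nat, C / e <= n%:R.
  exists (Num.bound `|C / e|).
  exact: le_trans (ler_norm _) (ltW (archi_boundP (normr_ge0 _))).
have n2 : n%:R <= 2 ^+ n :> R by rewrite -natrX ler_nat ltnW// ltn_expl.
apply: le_trans (h n) _; rewrite lerD2l ler_pdivrMr ?exprn_gt0// mulrC.
by rewrite -ler_pdivrMr//; exact: le_trans Cn n2.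
Qed.

Lemma le0_of_halving (x C : R) : (forall n, `|x| <= C / 2 ^+ n) -> x = 0.
Proof.
move=> h; apply/normr0_eq0/eqP; rewrite eq_le normr_ge0 andbT.
by apply: (@le_of_halving _ _ C) => n; rewrite add0r.
Qed.

(** The intervals centred at [u n] with radius 2 r / 2^n, the tail of the geometric series, are
    nested, because the radius decreases by exactly r / 2^n at each step. The supremum of the left
    endpoints lies in all of them. *)
Lemma halving_limit (u : nat -> R) (r : R) :
  (forall n, `|u n.+1 - u n| <= r / 2 ^+ n) ->
  exists l, forall n, `|l - u n| <= 2 * r / 2 ^+ n.
Proof.
move=> hu; pose a n := u n - 2 * r / 2 ^+ n; pose b n := u n + 2 * r / 2 ^+ n.
have step n : 2 * r / 2 ^+ n - 2 * r / 2 ^+ n.+1 = r / 2 ^+ n.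
  by rewrite exprS; field; rewrite expf_neq0.
have aS n : a n <= a n.+1.
  by move: (hu n) (step n); rewrite ler_norml /a => /andP[]; lra.
have bS n : b n.+1 <= b n.
  by move: (hu n) (step n); rewrite ler_norml /b => /andP[]; lra.
have r0 : 0 <= r by have := hu 0%N; rewrite expr0 divr1; apply: le_trans.
have ab n : a n <= b n.
  have : 0 <= 2 * r / 2 ^+ n by rewrite divr_ge0 ?exprn_ge0 ?mulr_ge0.
  by rewrite /a /b; lra.
have amono : {homo a : m n / (m <= n)%N >-> m <= n}.
  exact: homo_leq (@lexx _ _) (@le_trans _ _) aS.
have bmono : {homo b : m n / (m <= n)%N >-> n <= m}.
  apply: homo_leq => //; first by move=> x y z xy yz; exact: le_trans yz xy.
have amb m n : a m <= b n.
  apply: le_trans (amono _ _ (leq_maxl m n)) _.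
  exact: le_trans (ab _) (bmono _ _ (leq_maxr m n)).
exists (sup (range a)) => n.
have aub : a n <= sup (range a).
  by apply: ub_le_sup; [exists (b 0%N) => _ [k _ <-]|exists n].
have bub : sup (range a) <= b n.
  by apply: ge_sup; [exists (a 0%N), 0%N|move=> _ [k _ <-]].
by move: aub bub; rewrite ler_norml /a /b => *; apply/andP; split; lra.
Qed.

Lemma mvt_bound f df (a h C : R) :
  (forall t, `|t - a| <= h -> is_derive t 1 f (df t)) ->
  (forall t, `|t - a| <= h -> `|df t| <= C) ->
  forall s t, `|s - a| <= h -> `|t - a| <= h -> `|f s - f t| <= C * `|s - t|.
Proof.
move=> fd dC.
suff main s t : s < t -> `|s - a| <= h -> `|t - a| <= h ->
    `|f s - f t| <= C * `|s - t|.
  move=> s t sh th; have [st|ts|->] := ltgtP s t; first exact: main.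
    by rewrite distrC [`|s - t|]distrC; exact: main.
  by rewrite !subrr normr0 mulr0.
move=> st sh th.
have inh x : s <= x <= t -> `|x - a| <= h.
  move: sh th; rewrite !ler_norml => /andP[? ?] /andP[? ?] /andP[? ?].
  by apply/andP; split; lra.
have [||c cst e] := @MVT R f df s t st.
- move=> x; by rewrite in_itv /= => /andP[? ?]; apply: fd; apply: inh; rewrite !ltW.
- apply: derivable_within_continuous => x; rewrite in_itv/= => xst.
  by have [] := fd _ (inh _ xst).
- rewrite distrC e normrM [`|s - t|]distrC ler_wpM2r//.
  by apply: dC; apply: inh; move: cst; rewrite in_itv/= => /andP[? ?]; rewrite !ltW.
Qed.

Lemma primitive_exists f (a : R) : continuous f ->
  exists G, G a = 0 /\ forall x, a - 1 < x -> is_derive x 1 G (f x).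
Proof.
(* Integrating from a - 1 makes the primitive differentiable on both sides of [a]; subtracting a
   constant restores the value 0 at [a]. *)
move=> cf; set b := a - 1.
pose F x := (\int[lebesgue_measure]_(t in [set` `[b, x]]) (f t))%R.
have dF x : b < x -> is_derive x 1 F (f x).
  move=> bx; have xu : x < x + 1 by rewrite ltrDl.
  have fi : lebesgue_measure.-integrable `[b, x + 1] (EFin \o f).
    apply: continuous_compact_integrable; first exact: segment_compact.
    exact: continuous_subspaceT.
  have [d1 d2] := continuous_FTC1_closed xu fi bx (cf x).
  by apply: DeriveDef; [exact: d1|rewrite -d2 derive1E].
exists (fun x => F x - F a); split; first by rewrite subrr.
move=> x bx; have dFx := dF x bx.
by have := is_deriveB dFx (is_derive_cst (F a) x 1); rewrite subr0.
Qed.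

Lemma lipschitz_continuous f (K : R) :
  (forall s t, `|f s - f t| <= K * `|s - t|) -> continuous f.
Proof.
move=> hf t; apply/cvgrPdist_lt => e e0.
have K0 : 0 < `|K| + 1 by rewrite ltr_wpDl.
near=> s; apply: le_lt_trans (hf t s) _.
apply: (@le_lt_trans _ _ ((`|K| + 1) * `|t - s|)).
  by rewrite ler_wpM2r// (le_trans (ler_norm _))// lerDl.
rewrite -ltr_pdivlMl//; near: s.
by apply: cvgr_dist_lt => //; rewrite mulr_gt0// invr_gt0.
Unshelve. all: by end_near. Qed.

Definition clamp (a h t : R) : R := Num.max (a - h) (Num.min (a + h) t).

Lemma clamp_dist (a h t : R) : 0 <= h -> `|clamp a h t - a| <= h.
Proof.
move=> h0; have ahh : a - h <= a + h by lra.
by rewrite /clamp ler_distl ge_max ahh ge_min lexx le_max lexx.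
Qed.

Lemma clamp_id (a h t : R) : `|t - a| <= h -> clamp a h t = t.
Proof.
by rewrite /clamp ler_distl => /andP[? ?]; rewrite min_r// max_r.
Qed.

Lemma clamp_lipschitz (a h s t : R) : `|clamp a h s - clamp a h t| <= `|s - t|.
Proof.
have max_lip (x y z : R) : `|Num.max x y - Num.max x z| <= `|y - z|.
  wlog yz : y z / y <= z => [hw|].
    have /orP[yz|zy] := le_total y z; first exact: hw.
    by rewrite distrC [leRHS]distrC; exact: hw.
  rewrite [leRHS]distrC [leRHS]ger0_norm ?subr_ge0// ler_norml.
  by case: (lerP x y) => ?; case: (lerP x z) => ?; apply/andP; split; lra.
have min_lip (x y z : R) : `|Num.min x y - Num.min x z| <= `|y - z|.
  wlog yz : y z / y <= z => [hw|].
    have /orP[yz|zy] := le_total y z; first exact: hw.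
    by rewrite distrC [leRHS]distrC; exact: hw.
  rewrite [leRHS]distrC [leRHS]ger0_norm ?subr_ge0// ler_norml.
  by case: (lerP x y) => ?; case: (lerP x z) => ?; apply/andP; split; lra.
exact: le_trans (max_lip _ _ _) (min_lip _ _ _).
Qed.

Lemma near_closed_ball (P : R -> Prop) (a : R) : (\near a, P a) ->
  exists2 h : R, 0 < h & forall t, `|t - a| <= h -> P t.
Proof.
move=> /nbhs_ballP[e /= e0 he]; exists (e / 2); first by rewrite divr_gt0.
move=> t th; apply: he; rewrite /ball /= distrC (le_lt_trans th)//.
by rewrite ltr_pdivrMr// ltr_pMr// ltr1n.
Qed.

End RealLemmas.

(* Local Lipschitz continuity at (t0, u0) for the sup norm on I -> R, in which
   [d] ranges over all the bounds of the distance between the two points. *)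
Definition lip_with {R : realType} {I : finType} (F : R -> (I -> R) -> R)
    (t0 : R) (u0 : I -> R) (r L : R) : Prop :=
  forall t s u v d, `|t - t0| <= r -> `|s - t0| <= r ->
    (forall j, `|u j - u0 j| <= r) -> (forall j, `|v j - u0 j| <= r) ->
    `|t - s| <= d -> (forall j, `|u j - v j| <= d) ->
    `|F t u - F s v| <= L * d.

Definition lip_near {R : realType} {I : finType} (F : R -> (I -> R) -> R)
    (t0 : R) (u0 : I -> R) : Prop :=
  exists r L, [/\ 0 < r, 0 <= L & lip_with F t0 u0 r L].

(** * Closure properties of local Lipschitz continuity *)

Section LipNear.
Context {R : realType} {I : finType}.
Implicit Types (F G : R -> (I -> R) -> R) (r L : R).

Lemma lip_with_le F (t0 : R) (u0 : I -> R) r r' L L' : r' <= r -> L <= L' ->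
  lip_with F t0 u0 r L -> lip_with F t0 u0 r' L'.
Proof.
move=> rr LL lF t s u v d tr sr ur vr ts uv.
have d0 : 0 <= d by apply: le_trans ts.
apply: le_trans (ler_wpM2r d0 LL); apply: lF => //.
- exact: le_trans rr.
- exact: le_trans rr.
- by move=> j; exact: le_trans rr.
- by move=> j; exact: le_trans rr.
Qed.

(** The least radius and the sum of the constants serve for all members; starting the minimum at 1
    keeps the radius positive even for an empty family. *)
Lemma lip_near_family (J : finType) (F : J -> R -> (I -> R) -> R) (t0 : R) (u0 : I -> R) :
  (forall i, lip_near (F i) t0 u0) ->
  exists r L, [/\ 0 < r, 0 <= L & forall i, lip_with (F i) t0 u0 r L].
Proof.
move=> lF.
have [r hr] := choice lF; have [L hL] := choice hr.
exists (\big[Num.min/1]_i r i), (\sum_i L i); split.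
- by apply: lt_bigmin => // i _; have [] := hL i.
- by apply: sumr_ge0 => i _; have [] := hL i.
- move=> i; have [_ _] := hL i; apply: lip_with_le.
    exact: bigmin_le_cond.
  by rewrite (bigD1 i)//= lerDl sumr_ge0// => k _; have [] := hL k.
Qed.

Lemma lip_near_cst (t0 : R) (u0 : I -> R) (c : R) : lip_near (fun _ _ => c) t0 u0.
Proof.
exists 1, 0; split => // t s u v d *; by rewrite subrr normr0 mul0r.
Qed.

Lemma lip_near_proj (t0 : R) (u0 : I -> R) (j : I) : lip_near (fun _ u => u j) t0 u0.
Proof. by exists 1, 1; split => // t s u v d *; rewrite mul1r. Qed.

Lemma lip_nearD F G (t0 : R) (u0 : I -> R) : lip_near F t0 u0 -> lip_near G t0 u0 ->
  lip_near (fun t u => F t u + G t u) t0 u0.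
Proof.
(* A family indexed by [bool] provides a common radius and constant for [F] and [G]. *)
move=> lF lG; pose H (b : bool) := if b then F else G.
have [b|r [L [r0 L0 lH]]] := @lip_near_family _ H t0 u0.
  by case: b.
exists r, (L + L); split; rewrite ?addr_ge0// => t s u v d *.
rewrite opprD addrACA mulrDl (le_trans (ler_normD _ _))//.
by apply: lerD; [apply: (lH true)|apply: (lH false)].
Qed.

Lemma lip_with_bounded F (t0 : R) (u0 : I -> R) r L : lip_with F t0 u0 r L -> 0 < r ->
  forall t u, `|t - t0| <= r -> (forall j, `|u j - u0 j| <= r) ->
  `|F t u| <= `|F t0 u0| + L * r.
Proof.
move=> lF r0 t u tr ur; rewrite -lerBlDl; apply: le_trans (lerB_dist _ _) _.
by apply: lF => // [|j]; rewrite subrr normr0 ltW.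
Qed.

Lemma lip_nearM F G (t0 : R) (u0 : I -> R) : lip_near F t0 u0 -> lip_near G t0 u0 ->
  lip_near (fun t u => F t u * G t u) t0 u0.
Proof.
move=> lF lG; pose H (b : bool) := if b then F else G.
have [b|r [L [r0 L0 lH]]] := @lip_near_family _ H t0 u0.
  by case: b.
(* [A] and [B] bound [F] and [G] on the whole ball, as needed to estimate F (G - G') + G' (F -
   F'). *)
pose A := `|F t0 u0| + L * r; pose B := `|G t0 u0| + L * r.
have A0 : 0 <= A by rewrite addr_ge0// mulr_ge0// ltW.
have B0 : 0 <= B by rewrite addr_ge0// mulr_ge0// ltW.
exists r, (A * L + B * L); split; rewrite ?addr_ge0 ?mulr_ge0//.
move=> t s u v d tr sr ur vr ts uv.
have -> : F t u * G t u - F s v * G s v =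
    F t u * (G t u - G s v) + G s v * (F t u - F s v) by ring.
rewrite (le_trans (ler_normD _ _))// !normrM mulrDl -!mulrA.
apply: lerD; apply: ler_pM => //.
- exact: (lip_with_bounded (lH true)).
- exact: (lH false).
- exact: (lip_with_bounded (lH false)).
- exact: (lH true).
Qed.

Lemma lip_near_sum (J : Type) (q : seq J) (F : J -> R -> (I -> R) -> R) (t0 : R) (u0 : I -> R) :
  (forall i, lip_near (F i) t0 u0) ->
  lip_near (fun t u => \sum_(i <- q) F i t u) t0 u0.
Proof.
move=> lF; elim: q => [|i q IH].
  have -> : (fun t u => \sum_(i <- [::]) F i t u) = fun _ _ => 0.
    by apply/funext => t; apply/funext => u; rewrite big_nil.
  exact: lip_near_cst.
have -> : (fun t u => \sum_(j <- i :: q) F j t u) =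
    fun t u => F i t u + \sum_(j <- q) F j t u.
  by apply/funext => t; apply/funext => u; rewrite big_cons.
exact: lip_nearD.
Qed.

End LipNear.

(** * Smooth functions are locally Lipschitz *)

Section LipSmooth.
Context {R : realType}.

(** The ball is convex, so the segment from [z] to [y] stays in it, and the mean value theorem
    applies to [g] along this segment, parametrized by [0, 1]. *)
Lemma differentiable_lip {V : normedModType R} (g : V -> R) (x0 : V) (C : R) :
  (\near x0, differentiable g x0 /\ forall v, `|'D_v g x0| <= C * `|v|) ->
  exists2 r : R, 0 < r & forall y z, `|y - x0| <= r -> `|z - x0| <= r ->
    `|g y - g z| <= C * `|y - z|.
Proof.
move=> /nbhs_ballP[e /= e0 he]; exists (e / 2); first by rewrite divr_gt0.
move=> y z yx zx.
pose p (s : R) := z + s *: (y - z).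
have pin (s : R) : 0 <= s <= 1 -> ball x0 e (p s).
  move=> /andP[s0 s1]; rewrite -ball_normE /= distrC.
  have -> : p s - x0 = (1 - s) *: (z - x0) + s *: (y - x0).
    rewrite scalerBl scale1r -[RHS]addrA [- (s *: _) + _]addrC -scalerBr.
    by rewrite opprB addrA subrK addrAC.
  rewrite (le_lt_trans (ler_normD _ _))// !normrZ !ger0_norm ?subr_ge0//.
  have := ler_wpM2l s0 yx; have s1' : 0 <= 1 - s by rewrite subr_ge0.
  by have := ler_wpM2l s1' zx; lra.
have pd (s : R) : is_diff s p ( *:%R^~ (y - z)).
  have -> : p = cst z + ( *:%R^~ (y - z)) by [].
  by apply: is_diff_eq; rewrite add0r.
have pD (s : R) : 'D_1 p s = y - z.
  by rewrite deriveE // diff_val scale1r.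
have gD (s : R) : 0 <= s <= 1 -> is_derive s 1 (g \o p) ('D_(y - z) g (p s)).
  move=> /pin /he[dg _]; have dp : differentiable p s by [].
  apply: DeriveDef; first exact/diff_derivable/differentiable_comp.
  by rewrite (derive_comp _ dp dg) pD.
have [s s01||c c01] := @MVT R (g \o p) (fun s => 'D_(y - z) g (p s)) 0 1 ltr01.
- by apply: gD; move: s01; rewrite in_itv /= => /andP[? ?]; rewrite !ltW.
- apply: derivable_within_continuous => s; rewrite in_itv /= => s01.
  by have [] := gD _ s01.
have -> : (g \o p) 1 = g y by rewrite /= /p scale1r addrC subrK.
have -> : (g \o p) 0 = g z by rewrite /= /p scale0r addr0.
move=> ->; rewrite subr0 mulr1; apply: (he _ _).2; apply: pin.
by move: c01; rewrite in_itv /= => /andP[? ?]; rewrite !ltW.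
Qed.

Lemma normr_row_le {n : nat} (v : 'rV[R]_n) (d : R) : 0 <= d ->
  (`|v| <= d) <-> (forall k, `|v 0 k| <= d).
Proof.
move=> d0; rewrite {1}/Num.Def.normr /= mx_normrE; split=> [h k|h].
  by apply: le_trans h; exact: (le_bigmax _ (fun ij => `|v ij.1 ij.2|) (0, k)).
by apply: bigmax_le => // -[i j] _ /=; rewrite (ord1 i).
Qed.

Lemma smooth_lip_row {n : nat} (U : set 'rV[R]_n) (g : 'rV[R]_n -> R) (x : 'rV[R]_n) :
  open U -> U x -> smooth_on U g ->
  exists r C : R, [/\ 0 < r, 0 <= C & forall y z, `|y - x| <= r -> `|z - x| <= r ->
    `|g y - g z| <= C * `|y - z|].
Proof.
move=> oU Ux sg.
(* Near [x] each partial derivative is bounded by its value at [x] plus 1, by continuity; a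
   directional derivative is the combination of the partial ones with weights at most the norm of
   [v]. *)
pose C := \sum_(k < n) (`|'D_(delta_mx 0 k) g x| + 1).
have C0 : 0 <= C by apply: sumr_ge0 => k _; rewrite addr_ge0.
suff [r r0 hr] : exists2 r : R, 0 < r & forall y z, `|y - x| <= r ->
    `|z - x| <= r -> `|g y - g z| <= C * `|y - z| by exists r, C.
have bDk (k : 'I_n) : \forall y \near x,
    `|'D_(delta_mx 0 k) g y| <= `|'D_(delta_mx 0 k) g x| + 1.
  have dD : differentiable ('D_(delta_mx 0 k) g) x.
    exact: smooth_on_differentiable (smooth_on_derive _ sg) Ux.
  near=> y; rewrite -lerBlDl (le_trans (lerB_dist _ _))// distrC ltW//; near: y.
  by have /cvgrPdist_lt /(_ _ ltr01) := differentiable_continuous dD.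
have bD := @filter_forall _ _ _ _ (nbhs_filter x) bDk.
apply: differentiable_lip; near=> y.
have Uy : U y by near: y; exact: open_nbhs_nbhs.
have dg : differentiable g y by exact: smooth_on_differentiable sg Uy.
split=> // v; rewrite (derive_row _ dg) (le_trans (ler_norm_sum _ _ _))//.
rewrite mulr_suml; apply: ler_sum => k _; rewrite normrM mulrC ler_pM//.
  by move: k; near: y.
by move: k; apply/normr_row_le.
Unshelve. all: by end_near. Qed.

Lemma smooth_lip_real (U : set R) (g : R -> R) (x : R) :
  open U -> U x -> smooth_on U g ->
  exists r C : R, [/\ 0 < r, 0 <= C & forall y z, `|y - x| <= r -> `|z - x| <= r ->
    `|g y - g z| <= C * `|y - z|].
Proof.
move=> oU Ux sg; pose C := `|'D_1 g x| + 1; have C0 : 0 <= C by rewrite addr_ge0.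
suff [r r0 hr] : exists2 r : R, 0 < r & forall y z, `|y - x| <= r ->
    `|z - x| <= r -> `|g y - g z| <= C * `|y - z| by exists r, C.
apply: differentiable_lip; near=> y.
have Uy : U y by near: y; exact: open_nbhs_nbhs.
have dg : differentiable g y by exact: smooth_on_differentiable sg Uy.
split=> // v.
have -> : 'D_v g y = v * 'D_1 g y.
  by rewrite !deriveE// diff1E//= scale1r.
rewrite normrM mulrC ler_wpM2r//; near: y.
have dD : differentiable ('D_1 g) x.
  exact: smooth_on_differentiable (smooth_on_derive _ sg) Ux.
near=> y; rewrite -lerBlDl (le_trans (lerB_dist _ _))// distrC ltW//; near: y.
by have /cvgrPdist_lt /(_ _ ltr01) := differentiable_continuous dD.
Unshelve. all: by end_near. Qed.

Lemma lip_near_time {I : finType} (U : set R) (g : R -> R) (t0 : R) (u0 : I -> R) :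
  open U -> U t0 -> smooth_on U g -> lip_near (fun t _ => g t) t0 u0.
Proof.
move=> oU Ut0 sg; have [r [C [r0 C0 h]]] := smooth_lip_real oU Ut0 sg.
exists r, C; split => // t s u v d tr sr _ _ ts _.
by rewrite (le_trans (h _ _ tr sr))// ler_wpM2l.
Qed.

(** Here [e] selects the coordinates of the state on which [g] depends: the Christoffel symbols
    depend on the position only, not on the frame. *)
Lemma lip_near_row {I : finType} {n : nat} (U : set 'rV[R]_n) (g : 'rV[R]_n -> R)
    (e : 'I_n -> I) (t0 : R) (u0 : I -> R) :
  open U -> U (\row_k u0 (e k)) -> smooth_on U g ->
  lip_near (fun _ u => g (\row_k u (e k))) t0 u0.
Proof.
move=> oU Uu sg; have [r [C [r0 C0 h]]] := smooth_lip_row oU Uu sg.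
exists r, C; split => // t s u v d tr sr ur vr ts uv.
have rowle w w' c : 0 <= c -> (forall j, `|w j - w' j| <= c) ->
    `|\row_k w (e k) - \row_k w' (e k)| <= c :> R.
  by move=> c0 hw; apply/normr_row_le => // k; rewrite !mxE.
rewrite (le_trans (h _ _ _ _))//; try exact: rowle (ltW r0) _.
by rewrite ler_wpM2l// rowle// (le_trans _ ts).
Qed.

End LipSmooth.

(** * Local existence and uniqueness for ordinary differential equations *)

Section ODE.
Context {R : realType} {I : finType}.
Variables (F : I -> R -> (I -> R) -> R).
Implicit Types (u v w : I -> R -> R).

(* On an interval of length h with L h <= 1/2 the Picard operator halves sup
   distances; [clamp] turns functions controlled only on the interval into
   continuous functions on R, which have primitives. *)
Lemma ode_existence (t0 : R) (u0 : I -> R) :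
  (forall i, lip_near (F i) t0 u0) ->
  exists2 h : R, 0 < h & exists2 w : I -> R -> R, (forall j, w j t0 = u0 j) &
    forall t, `|t - t0| <= h -> forall i, is_derive t 1 (w i) (F i t (w^~ t)).
Proof.
move=> /lip_near_family[r [L [r0 L0 lF]]].
pose B := (\sum_i `|F i t0 u0|) + L * r.
have B0 : 0 <= B by rewrite addr_ge0 ?sumr_ge0// mulr_ge0// ltW.
have FB i t (u : I -> R) : `|t - t0| <= r -> (forall j, `|u j - u0 j| <= r) ->
    `|F i t u| <= B.
  move=> tr ur; apply: le_trans (lip_with_bounded (lF i) r0 tr ur) _.
  by rewrite lerD2r (bigD1 i)//= lerDl sumr_ge0.
(* The bound h < 1 keeps the interval where the primitives are differentiable, L h <= 1/2 makes the
   Picard operator a contraction, and B h <= r keeps the iterates in the ball where [F] is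
   controlled. *)
have [h [h0 h1 hr hL hB]] :
    exists h : R, [/\ 0 < h, h < 1, h <= r, L * h <= 1 / 2 & B * h <= r].
  exists (Num.min (1 / 2) (Num.min r (Num.min (1 / (2 * (L + 1))) (r / (B + 1))))).
  set h := Num.min _ _.
  have : [/\ h <= 1 / 2, h <= r, h <= 1 / (2 * (L + 1)) & h <= r / (B + 1)].
    by split; rewrite /h !ge_min lexx ?orbT.
  have hpos : 0 < h.
    by rewrite !lt_min !divr_gt0 ?r0 ?mulr_gt0 ?ltr_wpDl ?ltr_pwDr.
  move=> [a1 a2 a3 a4]; split => //; first lra.
    move: a3; rewrite ler_pdivlMr ?mulr_gt0 ?ltr_wpDl// => a3; nra.
  by move: a4; rewrite ler_pdivlMr ?ltr_wpDl// => a4; nra.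
(* The class of functions preserved by the Picard operator: the right initial value, and the
   Lipschitz constant B on the interval, which forces the values into the ball of radius r. *)
pose ok u := forall j, u j t0 = u0 j /\ forall s t, `|s - t0| <= h ->
  `|t - t0| <= h -> `|u j s - u j t| <= B * `|s - t|.
have t0h : `|t0 - t0| <= h by rewrite subrr normr0 ltW.
have okr u t j : ok u -> `|t - t0| <= h -> `|u j t - u0 j| <= r.
  move=> /(_ j)[<- uB] th; apply: le_trans (uB _ _ th t0h) _.
  by apply: le_trans hB; rewrite ler_wpM2l.
pose c := clamp t0 h.
have ch t : `|c t - t0| <= h by exact: clamp_dist (ltW h0).
have cid t : `|t - t0| <= h -> c t = t by exact: clamp_id.
have cl s t : `|c s - c t| <= `|s - t| by exact: clamp_lipschitz.
(* The condition [ok u] is put inside the existential so that [choice] yields an operator [S]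
   defined on all functions. *)
have step u : exists w, ok u -> ok w /\ forall t, `|t - t0| <= h -> forall i,
    is_derive t 1 (w i) (F i t (u^~ t)).
  have [uok|nok] := pselect (ok u); last by exists u.
  pose f i s := F i (c s) (u^~ (c s)).
  have fc i : continuous (f i).
    apply: (@lipschitz_continuous _ _ (L * (1 + B))) => s t.
    rewrite -mulrA; apply: (lF i).
    - exact: le_trans (ch _) hr.
    - exact: le_trans (ch _) hr.
    - by move=> j; exact: okr.
    - by move=> j; exact: okr.
    - by rewrite (le_trans (cl _ _))// ler_peMl// lerDl.
    - move=> j; rewrite (le_trans ((uok j).2 _ _ (ch _) (ch _)))//.
      by apply: ler_pM => //; rewrite lerDr.
  have [G hG] := choice (fun i => primitive_exists t0 (fc i)).
  pose w i t := u0 i + G i t.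
  have wd t : `|t - t0| <= h -> forall i, is_derive t 1 (w i) (F i t (u^~ t)).
    move=> th i; have t1 : t0 - 1 < t.
      by move: th; rewrite ler_norml => /andP[? ?]; lra.
    have Gd := (hG i).2 _ t1.
    have := is_deriveD (is_derive_cst (u0 i) t 1) Gd.
    by rewrite add0r /f (cid _ th).
  exists w => _; split => // j; split; first by rewrite /w (hG j).1 addr0.
  apply: (mvt_bound (df := fun t => F j t (u^~ t))) => t th; first exact: wd.
  by apply: FB => [|k]; [exact: le_trans hr|exact: okr].
have [S hS] := choice step.
have contr u v d : ok u -> ok v ->
    (forall t j, `|t - t0| <= h -> `|u j t - v j t| <= d) ->
    forall t j, `|t - t0| <= h -> `|S u j t - S v j t| <= d / 2.
  move=> uok vok uv t j th; have [[Suok Sud] [Svok Svd]] := (hS _ uok, hS _ vok).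
  have d0 : 0 <= d by apply: le_trans (uv t0 j t0h).
  have dB x : `|x - t0| <= h ->
      is_derive x 1 (S u j \- S v j) (F j x (u^~ x) - F j x (v^~ x)).
    by move=> xh; have dx := Sud _ xh j; have dy := Svd _ xh j; exact: is_deriveB.
  have FB' x : `|x - t0| <= h -> `|F j x (u^~ x) - F j x (v^~ x)| <= L * d.
    move=> xh; apply: (lF j).
    - exact: le_trans hr.
    - exact: le_trans hr.
    - by move=> k; exact: okr.
    - by move=> k; exact: okr.
    - by rewrite subrr normr0.
    - by move=> k; exact: uv.
  have := mvt_bound dB FB' th t0h.
  rewrite /= (Suok j).1 (Svok j).1 subrr subr0 => /le_trans; apply.
  have : L * d * `|t - t0| <= L * d * h by rewrite ler_wpM2l// mulr_ge0.
  by have := ler_wpM2r d0 hL; lra.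
pose un n := iter n S (fun j _ => u0 j).
have unok n : ok (un n).
  elim: n => [|n IH]; last by have [] := hS _ IH.
  by move=> j; split => // s t _ _; rewrite subrr normr0 mulr_ge0.
have undist n t j : `|t - t0| <= h -> `|un n.+1 j t - un n j t| <= r / 2 ^+ n.
  elim: n t j => [|n IH] t j th.
    by rewrite expr0 divr1; exact: (okr (un 1%N)).
  rewrite exprSr invfM mulrA; exact: (contr (un n.+1) (un n)).
have lim j t : exists l, `|t - t0| <= h -> forall n, `|l - un n j t| <= 2 * r / 2 ^+ n.
  have [th|_] := boolP (`|t - t0| <= h); last by exists 0.
  have [l hl] := @halving_limit _ (fun n => un n j t) r (fun n => undist n t j th).
  by exists l.
have [V hV] := choice (fun jt : I * R => lim jt.1 jt.2).
pose U j t := V (j, t).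
have hU j t : `|t - t0| <= h -> forall n, `|U j t - un n j t| <= 2 * r / 2 ^+ n.
  exact: (hV (j, t)).
have Uok : ok U.
  move=> j; split.
    apply/eqP; rewrite -subr_eq0; apply/eqP.
    apply: (@le0_of_halving _ _ (2 * r)) => n.
    by have := hU j t0 t0h n; rewrite (unok n j).1.
  (* The n-th iterate is within 2 r / 2^n of the limit at each of the two points [s] and [t]. *)
  move=> s t sh th; apply: (@le_of_halving _ _ _ (2 * (2 * r))) => n.
  have := hU j s sh n; have := hU j t th n; have := (unok n j).2 _ _ sh th.
  rewrite -!mulrA ![2 * (2 * _)]mulr_natl mulr2n.
  rewrite !ler_norml => /andP[? ?] /andP[? ?] /andP[? ?].
  by apply/andP; split; lra.
have [SUok SUd] := hS _ Uok.
have SUE t j : `|t - t0| <= h -> S U j t = U j t.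
  move=> th; apply/eqP; rewrite -subr_eq0; apply/eqP.
  apply: (@le0_of_halving _ _ (2 * r)) => n.
  have c1 := contr _ _ _ Uok (unok n) (fun s k sh => hU k s sh n) t j th.
  have := hU j t th n.+1; rewrite exprSr invfM mulrA.
  move: c1; rewrite -[S (un n)]/(un n.+1).
  rewrite !ler_norml => /andP[? ?] /andP[? ?].
  by apply/andP; split; lra.
(* The witness is [S U] rather than [U]: the two are compared only on the closed interval, while the
   derivative at its endpoints is two-sided. *)
exists h => //; exists (S U); first by move=> j; rewrite (SUok j).1.
move=> t th i; have := SUd t th i.
suff -> : U^~ t = (S U)^~ t by [].
by apply/funext => j; rewrite SUE.
Qed.

(** Both solutions stay within r of the initial value, hence within 2 r of each other. When L h <=
    1/2, the mean value inequality halves any bound on their distance over the interval; iterating,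
    the distance is 0. *)
Lemma ode_local_uniqueness (t0 : R) (u0 : I -> R) u v :
  (forall i, lip_near (F i) t0 u0) ->
  (forall j, u j t0 = u0 j) -> (forall j, v j t0 = u0 j) ->
  (\forall t \near t0, forall i, is_derive (t : R) 1 (u i) (F i t (u^~ t))) ->
  (\forall t \near t0, forall i, is_derive (t : R) 1 (v i) (F i t (v^~ t))) ->
  \forall t \near t0, forall j, u j t = v j t.
Proof.
move=> /lip_near_family[r [L [r0 L0 lF]]] ut0 vt0 du dv.
have close w : (forall j, w j t0 = u0 j) ->
    (\forall t \near t0, forall i, is_derive (t : R) 1 (w i) (F i t (w^~ t))) ->
    \forall t \near t0, forall j, `|w j t - u0 j| <= r.
  move=> wt0 dw; apply: (@filter_forall _ _ _ _ (nbhs_filter t0)) => j.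
  have wc : {for t0, continuous (w j)}.
    apply: differentiable_continuous; apply/derivable1_diffP.
    by have [] := nbhs_singleton dw j.
  by near=> t; rewrite distrC -wt0 ltW//; near: t; have /cvgrPdist_lt := wc; exact.
have [h0 h0p hP] : exists2 h : R, 0 < h & forall t, `|t - t0| <= h ->
    [/\ forall i, is_derive (t : R) 1 (u i) (F i t (u^~ t)),
        forall i, is_derive (t : R) 1 (v i) (F i t (v^~ t)),
        forall j, `|u j t - u0 j| <= r & forall j, `|v j t - u0 j| <= r].
  apply: near_closed_ball; have cu := close _ ut0 du; have cv := close _ vt0 dv.
  by near=> t; split; near: t.
pose h := Num.min h0 (Num.min r (1 / (2 * (L + 1)))).
have [hh0 hr hL] : [/\ h <= h0, h <= r & h <= 1 / (2 * (L + 1))].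
  by split; rewrite /h !ge_min lexx ?orbT.
have hpos : 0 < h by rewrite !lt_min h0p r0 divr_gt0// mulr_gt0// ltr_wpDl.
have {}hL : L * h <= 1 / 2.
  by move: hL; rewrite ler_pdivlMr ?mulr_gt0 ?ltr_wpDl// => hL; nra.
have t0h : `|t0 - t0| <= h by rewrite subrr normr0 ltW.
have uv n t j : `|t - t0| <= h -> `|u j t - v j t| <= 2 * r / 2 ^+ n.
  elim: n t j => [|n IH] t j th.
    have [_ _ /(_ j) + /(_ j)] := hP _ (le_trans th hh0).
    rewrite expr0 divr1 !ler_norml => /andP[? ?] /andP[? ?].
    by apply/andP; split; lra.
  have dB x : `|x - t0| <= h ->
      is_derive x 1 (u j \- v j) (F j x (u^~ x) - F j x (v^~ x)).
    move=> xh; have [dx dy _ _] := hP _ (le_trans xh hh0).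
    by have := dx j; have := dy j => *; exact: is_deriveB.
  have FB x : `|x - t0| <= h ->
      `|F j x (u^~ x) - F j x (v^~ x)| <= L * (2 * r / 2 ^+ n).
    move=> xh; have [_ _ ux vx] := hP _ (le_trans xh hh0); apply: (lF j) => //.
    - exact: le_trans hr.
    - exact: le_trans hr.
    - by rewrite subrr normr0 divr_ge0 ?exprn_ge0// mulr_ge0// ltW.
    - by move=> k; exact: IH.
  have d0 : 0 <= 2 * r / 2 ^+ n by rewrite divr_ge0 ?exprn_ge0// mulr_ge0// ltW.
  have -> : 2 * r / 2 ^+ n.+1 = 2 * r / 2 ^+ n / 2 by rewrite exprSr invfM mulrA.
  set d := 2 * r / 2 ^+ n in d0 FB *.
  have := mvt_bound dB FB th t0h.
  rewrite /= ut0 vt0 subrr subr0 => /le_trans; apply.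
  have : L * d * `|t - t0| <= L * d * h by rewrite ler_wpM2l// mulr_ge0.
  by have := ler_wpM2r d0 hL; lra.
apply/nbhs_ballP; exists h => //= t; rewrite /ball/= distrC => /ltW th j.
apply/eqP; rewrite -subr_eq0; apply/eqP.
by apply: (@le0_of_halving _ _ (2 * r)) => n; exact: uv.
Unshelve. all: by end_near. Qed.

End ODE.

(** * Charts, connections and derivatives along curves *)

Lemma mulmx_row_ext {R : pzRingType} {p q : nat} (A B : 'M[R]_(p, q)) :
  (forall v : 'rV_p, v *m A = v *m B) -> A = B.
Proof. by move=> AB; apply/row_matrixP => i; rewrite !rowE. Qed.

Section Charts.
Context {R : realType} {m : nat} (M : smooth_manifold R m).
Implicit Types (x : M) (i j c h : chart_index M) (k l : 'I_m) (U : set M).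

Lemma chart_image_openI i U : open U -> open (chart i @` (chart_dom i `&` U)).
Proof.
move=> oU; have -> : chart i @` (chart_dom i `&` U) =
    chart i @` chart_dom i `&` chart_inv i @^-1` U.
  apply/seteqP; split=> [_ [x [ix Ux] <-]|_ [[x ix <-] Ux]].
    by split; [exists x|rewrite /= chartK].
  by exists x => //; split => //; move: Ux; rewrite /= chartK.
rewrite openE => y [iy Uy].
apply: filterI; first exact: open_nbhs_nbhs (conj (@chart_image_open _ _ _ i) iy).
apply: (chart_inv_continuous iy); exact: open_nbhs_nbhs.
Qed.

Lemma near_chart_dom (T : topologicalType) (f : T -> M) (t : T) i :
  {for t, continuous f} -> chart_dom i (f t) -> \forall s \near t, chart_dom i (f s).
Proof.
move=> cf it; apply: cf; apply: open_nbhs_nbhs; split => //.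
exact: chart_dom_open.
Qed.

Lemma near_chart_inv_dom i j x : chart_dom i x -> chart_dom j x ->
  \forall y \near chart i x, chart_dom j (chart_inv i y).
Proof.
move=> ix jx; apply: near_chart_dom; last by rewrite chartK.
by apply: chart_inv_continuous; exists x.
Qed.

Lemma transition_differentiable i j x : chart_dom i x -> chart_dom j x ->
  differentiable (chart j \o chart_inv i) (chart i x).
Proof.
move=> ix jx; apply: smooth_on_differentiable (@transition_smooth _ _ _ i j) _.
by exists x.
Qed.

Lemma transition_derive i j x v : chart_dom i x -> chart_dom j x ->
  'D_v (chart j \o chart_inv i) (chart i x) = v *m transition_jac i j x.
Proof. by move=> ix jx; rewrite deriveEjacobian//; exact: transition_differentiable. Qed.

(** The chain rule. The composite of the two changes of chart agrees with the direct one only near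
    the point, where the intermediate point remains in the domain of [j]; this suffices for
    derivatives. *)
Lemma transition_jacM i j (k : chart_index M) x : chart_dom i x -> chart_dom j x -> chart_dom k x ->
  transition_jac i j x *m transition_jac j k x = transition_jac i k x.
Proof.
move=> ix jx kx; apply: mulmx_row_ext => v.
have E1 := transition_derive v ix jx.
have E2 := transition_derive (v *m transition_jac i j x) jx kx.
have dk := transition_differentiable jx kx.
have jE : chart j x = (chart j \o chart_inv i) (chart i x) by rewrite /= chartK.
rewrite mulmxA; apply: etrans (esym E2) _.
apply: etrans _ (transition_derive v ix kx).
rewrite -E1; rewrite jE in dk *.
rewrite -(derive_comp _ (transition_differentiable ix jx) dk).
apply: near_eq_derive; apply: filterS (near_chart_inv_dom ix jx) => y jy.
by rewrite /= chartK.
Qed.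

Lemma transition_jac1 i x : chart_dom i x -> transition_jac i i x = 1%:M.
Proof.
move=> ix; apply: mulmx_row_ext => v; rewrite mulmx1 -(transition_derive _ ix ix).
rewrite -[RHS](derive_id (chart i x)); apply: near_eq_derive.
apply: filterS (open_nbhs_nbhs (conj (@chart_image_open _ _ _ i) _)); last by exists x.
by move=> _ [z iz <-]; rewrite /= chartK.
Qed.

Lemma tcomp_jac i j x v : chart_dom i x -> chart_dom j x ->
  tcomp i x v *m transition_jac i j x = tcomp j x v.
Proof.
by move=> ix jx; rewrite /tcomp -mulmxA transition_jacM//; exact: chart_at_dom.
Qed.

Lemma tcomp_jacV i x v : chart_dom i x ->
  tcomp i x (v *m transition_jac i (chart_at x) x) = v.
Proof.
move=> ix; have px := chart_at_dom x.
by rewrite /tcomp -mulmxA transition_jacM// transition_jac1// mulmx1.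
Qed.

Lemma tcomp_chart_at x v : tcomp (chart_at x) x v = v.
Proof. by rewrite /tcomp transition_jac1 ?mulmx1//; exact: chart_at_dom. Qed.

Lemma tcompV i x v : chart_dom i x ->
  tcomp i x v *m transition_jac i (chart_at x) x = v.
Proof.
by move=> ix; rewrite tcomp_jac ?tcomp_chart_at//; exact: chart_at_dom.
Qed.

Lemma tcomp_inj i x : chart_dom i x -> injective (tcomp i x).
Proof. by move=> ix u v uv; rewrite -(tcompV u ix) uv tcompV. Qed.

Lemma tcompD i x u v : tcomp i x (u + v) = tcomp i x u + tcomp i x v.
Proof. exact: mulmxDl. Qed.

Lemma tcompZ i x (a : R) v : tcomp i x (a *: v) = a *: tcomp i x v.
Proof. by rewrite /tcomp -scalemxAl. Qed.

Lemma tcomp_sum i x (I : Type) (r : seq I) (P : pred I) (F : I -> 'rV[R]_m) :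
  tcomp i x (\sum_(a <- r | P a) F a) = \sum_(a <- r | P a) tcomp i x (F a).
Proof. exact: mulmx_suml. Qed.

Lemma tcomp_coord_field i j k x : chart_dom i x -> chart_dom j x ->
  tcomp j x (coord_field i k x) = delta_mx 0 k *m transition_jac i j x.
Proof.
by move=> ix jx; rewrite /tcomp -mulmxA transition_jacM//; exact: chart_at_dom.
Qed.

Lemma tcomp_coord_field_id i k x : chart_dom i x ->
  tcomp i x (coord_field i k x) = delta_mx 0 k.
Proof. by move=> ix; rewrite tcomp_coord_field// transition_jac1// mulmx1. Qed.

Lemma coord_field_sum i x v : chart_dom i x ->
  v = \sum_k tcomp i x v 0 k *: coord_field i k x.
Proof.
move=> ix; apply: (tcomp_inj ix); rewrite tcomp_sum.
under eq_bigr do rewrite tcompZ tcomp_coord_field_id//.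
exact: row_sum_delta.
Qed.

Lemma coord_field_transition i j k x : chart_dom i x -> chart_dom j x ->
  coord_field i k x = \sum_l transition_jac i j x k l *: coord_field j l x.
Proof.
move=> ix jx; rewrite {1}(coord_field_sum (coord_field i k x) jx).
by apply: eq_bigr => l _; rewrite tcomp_coord_field// -rowE mxE.
Qed.

(** The entries of the Jacobian are partial derivatives of a transition map, functions of the
    coordinates in the chart [i]; the change of chart from [h] to [i] makes them functions of those
    in [h]. *)
Lemma smooth_transition_jac i j h :
  smooth_on (chart h @` (chart_dom h `&` (chart_dom i `&` chart_dom j)))
    (fun y => transition_jac i j (chart_inv h y)).
Proof.
have oU c d : open (chart c @` (chart_dom c `&` chart_dom d)).
  by apply: chart_image_openI; exact: chart_dom_open.
have oU3 : open (chart h @` (chart_dom h `&` (chart_dom i `&` chart_dom j))).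
  by apply: chart_image_openI; apply: openI; exact: chart_dom_open.
apply/smooth_on_mxP => // a b.
apply: (@eq_smooth_on _ _ _ _ (fun y =>
    ('D_(delta_mx 0 a) (chart j \o chart_inv i)) ((chart i \o chart_inv h) y) 0 b)) => //.
  move=> y; rewrite inE => -[x [hx [ix jx]] <-].
  by rewrite [_ (chart h x)]/= !chartK// transition_derive// -rowE mxE.
apply: (smooth_on_comp_scalar (U' := chart i @` (chart_dom i `&` chart_dom j))
  (g := fun z => ('D_(delta_mx 0 a) (chart j \o chart_inv i)) z 0 b)
  (f := chart i \o chart_inv h)) => //.
- move=> _ [x [hx [ix jx]] <-]; exists x => //.
  by rewrite /= chartK.
- apply: smooth_on_subset (@transition_smooth _ _ _ h i).
  by move=> _ [x [hx [ix jx]] <-]; exists x.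
- apply: (smooth_on_mxP _ (oU i j)).1.
  by apply: smooth_on_derive; exact: transition_smooth.
Qed.

Lemma smooth_fun_transition_jac i j k l :
  smooth_fun (chart_dom i `&` chart_dom j) (fun x => transition_jac i j x k l).
Proof.
move=> h; have := @smooth_transition_jac i j h.
move/smooth_on_mxP; apply; apply: chart_image_openI.
by apply: openI; exact: chart_dom_open.
Qed.

Lemma smooth_coord_field i k : smooth_vfield (chart_dom i) (coord_field i k).
Proof.
move=> h; have oU : open (chart h @` (chart_dom h `&` chart_dom i)).
  by apply: chart_image_openI; exact: chart_dom_open.
apply: (@eq_smooth_on _ _ _ _ (fun y =>
    delta_mx 0 k *m transition_jac i h (chart_inv h y)) _ oU).
  move=> y; rewrite inE => -[x [hx ix] <-]; rewrite (chartK hx).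
  exact/esym/tcomp_coord_field.
apply: (smooth_on_mulmx oU); first exact: smooth_on_cst.
apply: smooth_on_subset (@smooth_transition_jac i h h).
by move=> _ [x [hx ix] <-]; exists x.
Qed.

End Charts.
Arguments chart_image_openI {R m M} i {U}.
Arguments smooth_coord_field {R m M} i k.
Arguments coord_field_sum {R m M i x} v.

Section DeriveHelpers.
Context {R : realType}.

Lemma is_derive_bigsum {n : nat} (F : 'I_n -> R -> R) (d : 'I_n -> R) (t : R) :
  (forall i, is_derive t 1 (F i) (d i)) ->
  is_derive t 1 (fun s => \sum_(i < n) F i s) (\sum_(i < n) d i).
Proof.
move=> hF; have -> : (fun s => \sum_(i < n) F i s) = \sum_(i < n) F i.
  by apply/funext => s; rewrite fct_sumE.
exact: is_derive_sum.
Qed.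

Lemma is_derive_mul (f g : R -> R) (df dg t : R) :
  is_derive t 1 f df -> is_derive t 1 g dg ->
  is_derive t 1 (fun s => f s * g s) (df * g t + f t * dg).
Proof.
move=> hf hg; apply: is_derive_eq (is_deriveM hf hg) _.
by rewrite /GRing.scale /= addrC [_ * df]mulrC.
Qed.

Lemma differentiable_is_derive (f : R -> R) (t : R) :
  differentiable f t -> is_derive t 1 f ('D_1 f t).
Proof. by move=> df; apply/derivableP/diff_derivable. Qed.

Lemma is_derive_differentiable {W : normedModType R} (f : R -> W) (d : W) (t : R) :
  is_derive t 1 f d -> differentiable f t.
Proof. by move=> [df _]; apply/derivable1_diffP. Qed.

End DeriveHelpers.

(** * Smooth functions and vector fields on open subsets of the manifold *)

Section SmoothFields.
Context {R : realType} {m : nat} (M : smooth_manifold R m).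
Implicit Types (x : M) (i c : chart_index M) (k : 'I_m) (U : set M).
Implicit Types (Y Z : M -> 'rV[R]_m) (f : M -> R).

Lemma eq_smooth_fun U f f' : open U -> {in U, f =1 f'} ->
  smooth_fun U f -> smooth_fun U f'.
Proof.
move=> oU ff sf i; apply: (eq_smooth_on (chart_image_openI i oU) _ (sf i)) => y.
by rewrite inE => -[x [ix Ux] <-] /=; rewrite chartK// ff// inE.
Qed.

Lemma eq_smooth_vfield U Y Z : open U -> {in U, Y =1 Z} ->
  smooth_vfield U Y -> smooth_vfield U Z.
Proof.
move=> oU YZ sY i; apply: (eq_smooth_on (chart_image_openI i oU) _ (sY i)) => y.
by rewrite inE => -[x [ix Ux] <-] /=; rewrite chartK// YZ// inE.
Qed.

Lemma smooth_vfield_subset U U' Y :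
  U `<=` U' -> smooth_vfield U' Y -> smooth_vfield U Y.
Proof.
move=> UU sf i; apply: smooth_on_subset (sf i).
by move=> _ [x [ix Ux] <-]; exists x => //; split => //; exact: UU.
Qed.

Lemma smooth_fun_cst U (a : R) : smooth_fun U (fun _ : M => a).
Proof. move=> i; exact: smooth_on_cst. Qed.

Lemma smooth_vfield0 U : smooth_vfield U (fun _ : M => 0).
Proof.
move=> i; have -> : (fun y => tcomp i (chart_inv i y) (0 : 'rV[R]_m)) = fun _ => 0.
  by apply/funext => y; rewrite /tcomp mul0mx.
exact: smooth_on_cst.
Qed.

Lemma smooth_vfieldD U Y Z : open U -> smooth_vfield U Y -> smooth_vfield U Z ->
  smooth_vfield U (fun x => Y x + Z x).
Proof.
move=> oU sY sZ i.
have -> : (fun y => tcomp i (chart_inv i y) (Y (chart_inv i y) + Z (chart_inv i y))) =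
    fun y => tcomp i (chart_inv i y) (Y (chart_inv i y)) +
             tcomp i (chart_inv i y) (Z (chart_inv i y)).
  by apply/funext => y; rewrite tcompD.
exact: (smooth_onD (chart_image_openI i oU)).
Qed.

Lemma smooth_vfieldZ U f Y : open U -> smooth_fun U f -> smooth_vfield U Y ->
  smooth_vfield U (fun x => f x *: Y x).
Proof.
move=> oU sf sY i; have oI := chart_image_openI i oU.
apply/(smooth_on_mxP _ oI) => a b.
have -> : (fun y => tcomp i (chart_inv i y) (f (chart_inv i y) *: Y (chart_inv i y)) a b)
    = fun y => (f \o chart_inv i) y * tcomp i (chart_inv i y) (Y (chart_inv i y)) a b.
  by apply/funext => y; rewrite tcompZ mxE.
by apply: (smooth_onM oI (sf i)); exact: (smooth_on_mxP _ oI).1.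
Qed.

Lemma smooth_vfield_sum U (I : Type) (r : seq I) (F : I -> M -> R)
    (Y : I -> M -> 'rV[R]_m) : open U ->
  (forall l, smooth_fun U (F l)) -> (forall l, smooth_vfield U (Y l)) ->
  smooth_vfield U (fun z => \sum_(l <- r) F l z *: Y l z).
Proof.
move=> oU sF sY; elim: r => [|l r IH].
  have -> : (fun z => \sum_(l <- [::]) F l z *: Y l z) = fun _ => 0.
    by apply/funext => z; rewrite big_nil.
  exact: smooth_vfield0.
have -> : (fun z => \sum_(j <- l :: r) F j z *: Y j z) =
    fun z => F l z *: Y l z + \sum_(j <- r) F j z *: Y j z.
  by apply/funext => z; rewrite big_cons.
by apply: smooth_vfieldD => //; exact: smooth_vfieldZ.
Qed.

End SmoothFields.

(** * Locality of connections and Christoffel symbols *)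

Section Connection.
Context {R : realType} {m : nat} (M : smooth_manifold R m).
Variable nabla : forall x : M, 'rV[R]_m -> (M -> 'rV[R]_m) -> 'rV[R]_m.
Hypothesis hnabla : affine_connection nabla.
Implicit Types (x : M) (i c : chart_index M) (k : 'I_m) (U : set M).
Implicit Types (Y Z : M -> 'rV[R]_m) (f : M -> R) (v : 'rV[R]_m).

(* Multiplying by the indicator function of the open set, which is smooth on it,
   makes the two fields equal everywhere; the Leibniz rule then compares them. *)
Lemma nabla_local U Y Z x v : open U -> U x -> {in U, Y =1 Z} ->
  smooth_vfield U Y -> nabla x v Y = nabla x v Z.
Proof.
move=> oU Ux YZ sY; have sZ := eq_smooth_vfield oU YZ sY.
pose f (z : M) : R := if pselect (U z) then 1 else 0.
have f1 z : U z -> f z = 1 by rewrite /f; case: pselect.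
have sf : smooth_fun U f.
  apply: (eq_smooth_fun oU _ (@smooth_fun_cst _ _ M U 1)).
  by move=> z; rewrite inE => Uz; rewrite f1.
have fYZ : (fun z => f z *: Y z) = (fun z => f z *: Z z).
  apply/funext => z; rewrite /f; case: pselect => Uz; last by rewrite !scale0r.
  by rewrite YZ// inE.
have := nabla_leibniz hnabla v oU sf sY Ux.
rewrite fYZ (nabla_leibniz hnabla v oU sf sZ Ux).
rewrite YZ ?inE// f1// !scale1r => /addrI; exact: esym.
Qed.

Lemma nabla0 x v : nabla x v (fun _ => 0) = 0.
Proof.
have := nabla_add hnabla v openT (@smooth_vfield0 _ _ M setT) (@smooth_vfield0 _ _ M setT) I.
have -> : (fun _ : M => (0 : 'rV[R]_m) + 0) = fun _ => 0.
  by apply/funext => z; rewrite addr0.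
move=> H; apply: (addrI (nabla x v (fun _ => 0))); rewrite addr0.
exact: esym (H x).
Qed.

Lemma nabla_leibniz_sum U (I : Type) (r : seq I) (F : I -> M -> R)
    (Y : I -> M -> 'rV[R]_m) x v : open U -> U x ->
  (forall l, smooth_fun U (F l)) -> (forall l, smooth_vfield U (Y l)) ->
  nabla x v (fun z => \sum_(l <- r) F l z *: Y l z) =
  \sum_(l <- r) (dfun (F l) x v *: Y l x + F l x *: nabla x v (Y l)).
Proof.
move=> oU Ux sF sY; elim: r => [|l r IH].
  have -> : (fun z => \sum_(l <- [::]) F l z *: Y l z) = fun _ => 0.
    by apply/funext => z; rewrite big_nil.
  by rewrite big_nil nabla0.
have -> : (fun z => \sum_(j <- l :: r) F j z *: Y j z) =
    fun z => F l z *: Y l z + \sum_(j <- r) F j z *: Y j z.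
  by apply/funext => z; rewrite big_cons.
rewrite big_cons -IH.
rewrite (nabla_add hnabla v oU (smooth_vfieldZ oU (sF l) (sY l))
  (smooth_vfield_sum r oU sF sY) Ux).
by rewrite (nabla_leibniz hnabla v oU (sF l) (sY l) Ux).
Qed.

Lemma nabla_linear_sum U (I : Type) (r : seq I) (a : I -> R) (u : I -> 'rV[R]_m) Y x :
  open U -> U x -> smooth_vfield U Y ->
  nabla x (\sum_(l <- r) a l *: u l) Y = \sum_(l <- r) a l *: nabla x (u l) Y.
Proof.
move=> oU Ux sY; elim: r => [|l r IH].
  (* The zero vector is written as -1 *: 0 + 0, so that linearity cancels its own derivative. *)
  rewrite !big_nil -[X in nabla x X Y](addNr 0) -scaleN1r.
  by rewrite (nabla_linear hnabla _ _ _ oU sY Ux) scaleN1r addNr.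
by rewrite !big_cons (nabla_linear hnabla _ _ _ oU sY Ux) IH.
Qed.

(** The row of the Christoffel symbols Gamma^l_(a k), with l as the column index. *)
Definition christoffel c (a k : 'I_m) x : 'rV[R]_m :=
  tcomp c x (nabla x (coord_field c a x) (coord_field c k)).

Lemma smooth_christoffel c a k :
  smooth_on (chart c @` chart_dom c) (fun y => christoffel c a k (chart_inv c y)).
Proof.
have /(_ c) := @nabla_smooth _ _ _ _ hnabla _ _ _ (@chart_dom_open _ _ M c)
  (smooth_coord_field c a) (smooth_coord_field c k).
by rewrite setIid.
Qed.

Lemma nabla_christoffel c k x v : chart_dom c x ->
  tcomp c x (nabla x v (coord_field c k)) =
  \sum_a tcomp c x v 0 a *: christoffel c a k x.
Proof.
move=> cx; rewrite {1}(coord_field_sum v cx).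
rewrite (nabla_linear_sum _ _ _ (@chart_dom_open _ _ M c) cx (smooth_coord_field c k)).
by rewrite tcomp_sum; apply: eq_bigr => a _; rewrite tcompZ.
Qed.

End Connection.

(** * Velocity and covariant derivative along a curve, in an arbitrary chart *)

Section AlongCurves.
Context {R : realType} {m : nat} (M : smooth_manifold R m).
Implicit Types (c i : chart_index M) (k : 'I_m) (U : set M) (f : M -> R).
Implicit Types (sigma : R -> M) (X Y : R -> 'rV[R]_m) (t : R).

Definition regular_curve sigma t : Prop :=
  {for t, continuous sigma} /\
  forall i, chart_dom i (sigma t) -> differentiable (chart i \o sigma) t.

Definition regular_field sigma X t : Prop :=
  forall i, chart_dom i (sigma t) ->
    differentiable (fun s => tcomp i (sigma s) (X s)) t.

Lemma velocityE sigma t :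
  velocity sigma t = 'D_1 (chart (chart_at (sigma t)) \o sigma) t.
Proof. by rewrite /velocity derive1E. Qed.

Lemma tcomp_velocity c sigma t : regular_curve sigma t -> chart_dom c (sigma t) ->
  tcomp c (sigma t) (velocity sigma t) = 'D_1 (chart c \o sigma) t.
Proof.
move=> [cs ds] ct; set p := chart_at (sigma t).
have pt : chart_dom p (sigma t) by exact: chart_at_dom.
have E := transition_derive (velocity sigma t) pt ct.
apply: etrans (esym E) _; rewrite velocityE -/p.
have dT := transition_differentiable pt ct.
rewrite -(derive_comp _ (ds _ pt) dT); apply: near_eq_derive.
apply: filterS (near_chart_dom cs pt) => s ps.
by rewrite /= chartK.
Qed.

(** Near [t] the curve stays in the preferred chart at [sigma t], so there [f \o sigma] factors
    through that single chart and the chain rule applies. *)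
Lemma dfun_curve U f sigma t : regular_curve sigma t -> open U -> U (sigma t) ->
  smooth_fun U f -> is_derive t 1 (f \o sigma) (dfun f (sigma t) (velocity sigma t)).
Proof.
move=> [cs ds] oU Ut sf; set p := chart_at (sigma t).
have pt : chart_dom p (sigma t) by exact: chart_at_dom.
have df : differentiable (f \o chart_inv p) (chart p (sigma t)).
  by apply: smooth_on_differentiable (sf p) _; exists (sigma t).
have dfs := differentiable_comp (ds _ pt) df.
have near_f : \forall s \near t,
    ((f \o chart_inv p) \o (chart p \o sigma)) s = (f \o sigma) s.
  by apply: filterS (near_chart_dom cs pt) => s ps; rewrite /= chartK.
apply: near_eq_is_derive near_f _; apply: DeriveDef.
  exact: diff_derivable.
by rewrite (derive_comp _ (ds _ pt) df) /dfun velocityE.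
Qed.

Lemma regular_field_comp c k sigma X t : regular_field sigma X t ->
  chart_dom c (sigma t) ->
  is_derive t 1 (fun s => tcomp c (sigma s) (X s) 0 k)
    ('D_1 (fun s => tcomp c (sigma s) (X s) 0 k) t).
Proof.
move=> rX ct; apply: differentiable_is_derive.
exact: (differentiable_mxP _ _).1 (rX _ ct) _ _.
Qed.

Variable nabla : forall x : M, 'rV[R]_m -> (M -> 'rV[R]_m) -> 'rV[R]_m.
Hypothesis hnabla : affine_connection nabla.

(** The expression of [covD] in a prescribed chart, which can remain the same when [t] varies. *)
Definition covD_in c sigma X t : 'rV[R]_m :=
  \sum_(k < m) ('D_1 (fun s => tcomp c (sigma s) (X s) 0 k) t *: coord_field c k (sigma t)
     + tcomp c (sigma t) (X t) 0 k *:
       nabla (sigma t) (velocity sigma t) (coord_field c k)).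

Lemma covDE sigma X t : covD nabla sigma X t = covD_in (chart_at (sigma t)) sigma X t.
Proof. by apply: eq_bigr => k _; rewrite derive1E. Qed.

(* Differentiating the change of components X^l = X^k A_kl produces the terms
   X^k V(A_kl) which the Leibniz rule produces when differentiating
   d_k = A_kl d_l. *)
Lemma covD_inE c sigma X t : regular_curve sigma t -> regular_field sigma X t ->
  chart_dom c (sigma t) -> covD nabla sigma X t = covD_in c sigma X t.
Proof.
move=> rs rX ct; rewrite covDE; set p := chart_at (sigma t).
have pt : chart_dom p (sigma t) by exact: chart_at_dom.
set x := sigma t; set V := velocity sigma t.
pose A (k l : 'I_m) (z : M) := transition_jac p c z k l.
set W := chart_dom p `&` chart_dom c.
have oW : open W by apply: openI; exact: chart_dom_open.
have Wt : W (sigma t) by split.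
have sA k l : smooth_fun W (A k l) by exact: smooth_fun_transition_jac.
have sC l : smooth_vfield W (coord_field c l).
  by apply: smooth_vfield_subset (smooth_coord_field c l) => z [].
have nabE k : nabla x V (coord_field p k) =
    \sum_l (dfun (A k l) x V *: coord_field c l x +
            A k l x *: nabla x V (coord_field c l)).
  rewrite -(nabla_leibniz_sum hnabla _ V oW Wt (sA k) sC).
  apply: (nabla_local hnabla V oW Wt).
    by move=> z; rewrite inE => -[pz cz]; exact: coord_field_transition.
  by apply: smooth_vfield_subset (smooth_coord_field p k) => z [].
have dA k l : is_derive t 1 (A k l \o sigma) (dfun (A k l) x V).
  exact: dfun_curve rs oW Wt (sA k l).
pose a (k : 'I_m) s := tcomp p (sigma s) (X s) 0 k.
pose b (l : 'I_m) s := tcomp c (sigma s) (X s) 0 l.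
have bE : \forall s \near t, forall l, b l s = \sum_k a k s * A k l (sigma s).
  have nc := near_chart_dom rs.1 ct; have np := near_chart_dom rs.1 pt.
  near=> s => l.
  have cs : chart_dom c (sigma s) by near: s.
  have ps : chart_dom p (sigma s) by near: s.
  apply: etrans (esym (congr1 (fun N : 'rV_m => N 0 l) (tcomp_jac (X s) ps cs))) _.
  by rewrite [LHS]mxE.
have da k := regular_field_comp k rX pt.
have db l : 'D_1 (b l) t = \sum_k ('D_1 (a k) t * A k l x + a k t * dfun (A k l) x V).
  have bEl : \forall s \near t, b l s = \sum_k a k s * (A k l \o sigma) s.
    by apply: filterS bE => s; apply.
  rewrite (near_eq_derive _ bEl).
  have := is_derive_bigsum (fun k => is_derive_mul (da k) (dA k l)).
  by move=> /@derive_val.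
rewrite /covD_in -/x -/V.
transitivity (\sum_k \sum_l (('D_1 (a k) t * A k l x + a k t * dfun (A k l) x V) *:
     coord_field c l x + (a k t * A k l x) *: nabla x V (coord_field c l))).
  apply: eq_bigr => k _.
  have E1 := coord_field_transition k pt ct.
  apply: etrans (congr2 (fun u v => 'D_1 (a k) t *: u + a k t *: v) E1 (nabE k)) _.
  rewrite !scaler_sumr -big_split /=; apply: eq_bigr => l _.
  by rewrite scalerDr !scalerA scalerDl addrA.
rewrite exchange_big; apply: eq_bigr => l _; rewrite big_split -!scaler_suml.
by congr (_ *: _ + _ *: _); [rewrite -db|rewrite [RHS](nbhs_singleton bE)].
Unshelve. all: by end_near. Qed.

(** The classical formula (X^l)' + X^k T^a Gamma^l_(a k), which turns the Frenet equations into an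
    explicit system in the chart [c]. *)
Lemma tcomp_covD c sigma X t l : regular_curve sigma t -> regular_field sigma X t ->
  chart_dom c (sigma t) ->
  tcomp c (sigma t) (covD nabla sigma X t) 0 l =
  'D_1 (fun s => tcomp c (sigma s) (X s) 0 l) t +
  \sum_k \sum_a tcomp c (sigma t) (X t) 0 k *
    (tcomp c (sigma t) (velocity sigma t) 0 a * christoffel nabla c a k (sigma t) 0 l).
Proof.
move=> rs rX ct; rewrite (covD_inE rs rX ct) /covD_in tcomp_sum.
pose a (k : 'I_m) s := tcomp c (sigma s) (X s) 0 k.
pose V := tcomp c (sigma t) (velocity sigma t).
have E k : tcomp c (sigma t) ('D_1 (a k) t *: coord_field c k (sigma t) +
      a k t *: nabla (sigma t) (velocity sigma t) (coord_field c k)) =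
    'D_1 (a k) t *: delta_mx 0 k +
    a k t *: \sum_b V 0 b *: christoffel nabla c b k (sigma t).
  rewrite tcompD !tcompZ; congr (_ *: _ + _ *: _).
    exact: tcomp_coord_field_id.
  exact: nabla_christoffel.
apply: etrans (congr1 (fun N : 'rV_m => N 0 l) (eq_bigr _ (fun k _ => E k))) _.
rewrite big_split [LHS]mxE !summxE; congr (_ + _).
  rewrite (bigD1 l)//= !mxE !eqxx mulr1 big1 ?addr0// => k kl.
  by rewrite !mxE eqxx eq_sym (negbTE kl) mulr0.
apply: eq_bigr => k _; rewrite mxE summxE mulr_sumr.
by apply: eq_bigr => b _; rewrite mxE.
Qed.

(** The Leibniz rule along the curve. Everything is evaluated at one instant, so the preferred chart
    at [sigma t] serves for all the fields and no change of chart is needed. *)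
Lemma covD_lincomb n (F : 'I_n -> R -> R) (X : 'I_n -> R -> 'rV[R]_m) sigma t :
  (forall l, differentiable (F l) t) -> (forall l, regular_field sigma (X l) t) ->
  covD nabla sigma (fun s => \sum_l F l s *: X l s) t =
  \sum_l ('D_1 (F l) t *: X l t + F l t *: covD nabla sigma (X l) t).
Proof.
move=> dF rX; rewrite covDE; set p := chart_at (sigma t).
have pt : chart_dom p (sigma t) by exact: chart_at_dom.
pose a l (k : 'I_m) s := tcomp p (sigma s) (X l s) 0 k.
have aE k : (fun s => tcomp p (sigma s) (\sum_l F l s *: X l s) 0 k) =
    fun s => \sum_l F l s * a l k s.
  apply/funext => s; rewrite tcomp_sum summxE.
  by apply: eq_bigr => l _; rewrite tcompZ mxE.
have daE k : 'D_1 (fun s => \sum_l F l s * a l k s) t =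
    \sum_l ('D_1 (F l) t * a l k t + F l t * 'D_1 (a l k) t).
  have dFl l := differentiable_is_derive (dF l).
  have dal l := regular_field_comp k (rX l) pt.
  have := is_derive_bigsum (fun l => is_derive_mul (dFl l) (dal l)).
  by move=> /@derive_val.
pose N k := nabla (sigma t) (velocity sigma t) (coord_field p k).
pose C k := coord_field p k (sigma t).
have XE l : X l t = \sum_k a l k t *: C k by exact: coord_field_sum.
transitivity (\sum_k \sum_l (('D_1 (F l) t * a l k t + F l t * 'D_1 (a l k) t) *: C k +
    (F l t * a l k t) *: N k)).
  apply: eq_bigr => k _; rewrite (aE k) daE.
  rewrite (congr1 (fun h : R -> R => h t) (aE k)) /=.
  by rewrite !scaler_suml -big_split.
rewrite exchange_big; apply: eq_bigr => l _.
rewrite covDE -/p /covD_in {1}XE !scaler_sumr -big_split /=.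
apply: eq_bigr => k _.
by rewrite scalerDl -!scalerA scalerDr -addrA.
Qed.

End AlongCurves.

(** * Metric compatibility *)

Section Metric.
Context {R : realType} {m : nat} (M : smooth_manifold R m).
Variable g : M -> 'rV[R]_m -> 'rV[R]_m -> R.
Hypothesis hg : riemannian_metric g.
Implicit Types (x : M) (u v w : 'rV[R]_m).

Lemma metric_suml x (I : Type) (r : seq I) (a : I -> R) (u : I -> 'rV[R]_m) w :
  g x (\sum_(l <- r) a l *: u l) w = \sum_(l <- r) a l * g x (u l) w.
Proof.
have g0 : g x 0 w = 0.
  have := metric_linear hg x w (-1) 0 0.
  by rewrite scaler0 addr0 /= mulN1r addNr.
elim: r => [|l r IH]; first by rewrite !big_nil.
by rewrite !big_cons -IH; exact: (metric_linear hg x w (a l) (u l) _).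
Qed.

Lemma metric_sumr x (I : Type) (r : seq I) (a : I -> R) (u : I -> 'rV[R]_m) w :
  g x w (\sum_(l <- r) a l *: u l) = \sum_(l <- r) a l * g x w (u l).
Proof.
rewrite (Defs.metric_sym hg) metric_suml.
by apply: eq_bigr => l _; rewrite (Defs.metric_sym hg).
Qed.

Lemma orthonormal_row_free x n (v : 'I_n -> 'rV[R]_m) :
  (forall a b, g x (v a) (v b) = (a == b)%:R) -> row_free (\matrix_(k < n) v k).
Proof.
move=> ov; rewrite -kermx_eq0; apply/rowV0P => w.
move/sub_kermxP; rewrite mulmx_sum_row => w0.
have {}w0 : \sum_i w 0 i *: v i = 0.
  by apply: etrans _ w0; apply: eq_bigr => i _; rewrite rowK.
apply/rowP => k; rewrite mxE.
have := metric_suml x (index_enum 'I_n) (fun i => w 0 i) v (v k).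
rewrite w0; have -> : g x 0 (v k) = 0.
  by have := metric_suml x [::] (fun i => w 0 i) v (v k); rewrite !big_nil.
move=> ->; rewrite (bigD1 k)//= ov eqxx mulr1 big1 ?addr0// => i ik.
by rewrite ov (negbTE ik) mulr0.
Qed.

Variable nabla : forall x : M, 'rV[R]_m -> (M -> 'rV[R]_m) -> 'rV[R]_m.
Hypothesis hnabla : levi_civita g nabla.
Implicit Types (sigma : R -> M) (X Y : R -> 'rV[R]_m) (t : R).

(** Metric compatibility is available for fields on open sets only. It is applied to the coordinate
    fields, which gives the derivative of the coefficients g_ab along the curve; the product rule
    for sum x^a y^b g_ab does the rest. *)
Lemma metric_derive sigma X Y t : regular_curve sigma t ->
  regular_field sigma X t -> regular_field sigma Y t ->
  is_derive t 1 (fun s => g (sigma s) (X s) (Y s))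
    (g (sigma t) (covD nabla sigma X t) (Y t) +
     g (sigma t) (X t) (covD nabla sigma Y t)).
Proof.
move=> rs rX rY; set p := chart_at (sigma t).
have pt : chart_dom p (sigma t) by exact: chart_at_dom.
have oU := @chart_dom_open _ _ M p.
pose C (k : 'I_m) (z : M) := coord_field p k z.
pose G a b (z : M) := g z (C a z) (C b z).
pose xc k s := tcomp p (sigma s) (X s) 0 k.
pose yc k s := tcomp p (sigma s) (Y s) 0 k.
set V := velocity sigma t.
pose N k := nabla (sigma t) V (coord_field p k).
have sG a b : smooth_fun (chart_dom p) (G a b) by exact: metric_smooth hg p a b.
have dG a b : is_derive t 1 (G a b \o sigma)
    (g (sigma t) (N a) (C b (sigma t)) + g (sigma t) (C a (sigma t)) (N b)).
  have <- := levi_civita_metric hnabla V oU (smooth_coord_field p a)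
    (smooth_coord_field p b) pt.
  exact: dfun_curve rs oU pt (sG a b).
have dx k : is_derive t 1 (xc k) ('D_1 (xc k) t) by exact: regular_field_comp.
have dy k : is_derive t 1 (yc k) ('D_1 (yc k) t) by exact: regular_field_comp.
have Eg : \forall s \near t, \sum_a \sum_b xc a s * yc b s * (G a b \o sigma) s =
    g (sigma s) (X s) (Y s).
  apply: filterS (near_chart_dom rs.1 pt) => s ps.
  have XE : X s = \sum_k xc k s *: C k (sigma s) by exact: coord_field_sum.
  have YE : Y s = \sum_k yc k s *: C k (sigma s) by exact: coord_field_sum.
  rewrite [RHS](congr2 (g (sigma s)) XE YE) metric_suml.
  apply: eq_bigr => a _; rewrite metric_sumr mulr_sumr.
  by apply: eq_bigr => b _; rewrite mulrA.
have XE : X t = \sum_k xc k t *: C k (sigma t) by exact: coord_field_sum.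
have YE : Y t = \sum_k yc k t *: C k (sigma t) by exact: coord_field_sum.
(* The derivative terms and the connection terms become two linear combinations indexed by [bool],
   to which bilinearity of [g] applies. *)
have covE Z zc : (forall k, zc k = fun s => tcomp p (sigma s) (Z s) 0 k) ->
    covD nabla sigma Z t =
    \sum_(o : bool) \sum_k (if o then 'D_1 (zc k) t else zc k t) *:
      (if o then C k (sigma t) else N k).
  move=> zcE; rewrite big_bool -big_split /= covDE.
  by apply: eq_bigr => k _; rewrite zcE.
apply: near_eq_is_derive Eg _.
have dterm a b := is_derive_mul (is_derive_mul (dx a) (dy b)) (dG a b).
apply: is_derive_eq (is_derive_bigsum (fun a => is_derive_bigsum (dterm a))) _.
have suml2 u v w : g (sigma t) (u + v) w = g (sigma t) u w + g (sigma t) v w.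
  by have := metric_linear hg (sigma t) w 1 u v; rewrite /= scale1r mul1r.
have sumr2 u v w : g (sigma t) w (u + v) = g (sigma t) w u + g (sigma t) w v.
  by rewrite (Defs.metric_sym hg) suml2 !(Defs.metric_sym hg _ w).
rewrite (covE X xc (fun=> erefl)) (covE Y yc (fun=> erefl)) !big_bool /=.
rewrite suml2 sumr2 {1}YE {1}YE XE.
rewrite !metric_suml -!big_split; apply: eq_bigr => a _ /=.
rewrite !metric_sumr !mulr_sumr -!big_split; apply: eq_bigr => b _ /=.
by rewrite /= /G; ring.
Qed.

Lemma orthonormal_near n (X : 'I_n -> R -> 'rV[R]_m) (K : 'I_n -> 'I_n -> R -> R)
    (U : set R) sigma t0 : open U -> U t0 ->
  (forall i j, smooth_on U (K i j)) -> (forall i j t, K i j t = - K j i t) ->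
  (forall t, U t -> regular_curve sigma t) ->
  (forall i t, U t -> regular_field sigma (X i) t) ->
  (forall i t, U t -> covD nabla sigma (X i) t = \sum_j K i j t *: X j t) ->
  (forall i j, g (sigma t0) (X i t0) (X j t0) = (i == j)%:R) ->
  \forall t \near t0, forall i j, g (sigma t) (X i t) (X j t) = (i == j)%:R.
Proof.
move=> oU Ut0 sK skew rs rX XK g0.
pose F (ij : 'I_n * 'I_n) (t : R) (w : 'I_n * 'I_n -> R) :=
  \sum_k K ij.1 k t * w (k, ij.2) + \sum_k K ij.2 k t * w (ij.1, k).
pose u (ij : 'I_n * 'I_n) t := g (sigma t) (X ij.1 t) (X ij.2 t).
pose w (ij : 'I_n * 'I_n) (t : R) : R := (ij.1 == ij.2)%:R.
suff : \forall t \near t0, forall ij, u ij t = w ij t.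
  by apply: filterS => t uw i j; exact: (uw (i, j)).
have nU : \forall t \near t0, U t by exact: open_nbhs_nbhs.
apply: (@ode_local_uniqueness _ _ F t0 (fun ij => w ij t0)) => //.
- move=> ij; apply: lip_nearD; apply: lip_near_sum => k;
    by apply: lip_nearM; [exact: lip_near_time (sK _ _)|exact: lip_near_proj].
- by move=> ij; exact: g0.
- apply: filterS nU => t Ut ij.
  have := metric_derive (rs t Ut) (rX ij.1 t Ut) (rX ij.2 t Ut).
  move=> H; apply: is_derive_eq H _; rewrite !XK// metric_suml metric_sumr.
  by [].
(* At the identity matrix the right-hand side is K_ij + K_ji, which is 0. *)
- apply: filterS nU => t Ut [i j]; apply: is_derive_eq.
  have delta (f : 'I_n -> R) k : \sum_l f l * (l == k)%:R = f k.
    rewrite (bigD1 k)//= eqxx mulr1 big1 ?addr0// => l lk.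
    by rewrite (negbTE lk) mulr0.
  rewrite /F /w /= delta.
  under [X in _ + X]eq_bigr do rewrite eq_sym.
  by rewrite delta (skew i j) addNr.
Qed.

End Metric.

(** * The Frenet equations *)

Lemma smooth_on_prod {R : realType} {V : normedModType R} (U : set V) (I : Type)
    (r : seq I) (F : I -> V -> R) : open U -> (forall i, smooth_on U (F i)) ->
  smooth_on U (fun x => \prod_(i <- r) F i x).
Proof.
move=> oU sF; elim: r => [|i r IH].
  have -> : (fun x => \prod_(i <- [::]) F i x) = fun _ => 1.
    by apply/funext => x; rewrite big_nil.
  exact: smooth_on_cst.
have -> : (fun x => \prod_(j <- i :: r) F j x) = fun x => F i x * \prod_(j <- r) F j x.
  by apply/funext => x; rewrite big_cons.
exact: smooth_onM.
Qed.

Lemma smooth_on_det {R : realType} {V : normedModType R} {n : nat} (U : set V)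
    (A : V -> 'M[R]_n) : open U -> smooth_on U A -> smooth_on U (fun x => \det (A x)).
Proof.
move=> oU sA; apply: smooth_on_sum => // s _; apply: smooth_onM => //.
  exact: smooth_on_cst.
apply: smooth_on_prod => // i; exact: (smooth_on_mxP _ oU).1.
Qed.

Section FrenetCoefficients.
Context {R : realType}.
Implicit Types (kappa : nat -> R -> R) (i j n : nat) (t : R).

(* The matrix of nabla_T in the Frenet frame, with rows and columns counted
   from 0: row i stands for X_(i+1). *)
Definition frenet_coef kappa i j t : R :=
  kappa 0%N t * ((if j == i.+1 then kappa j t else 0) -
                 (if i == j.+1 then kappa i t else 0)).

Lemma frenet_coef_skew kappa i j t : frenet_coef kappa i j t = - frenet_coef kappa j i t.
Proof. by rewrite /frenet_coef; ring. Qed.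

Lemma smooth_frenet_coef (U : set R) kappa n i j : open U ->
  (forall k, (k < n)%N -> smooth_on U (kappa k)) -> (i < n)%N -> (j < n)%N ->
  smooth_on U (frenet_coef kappa i j).
Proof.
move=> oU sk iltn jltn; rewrite /frenet_coef.
have sif (b : bool) k : (k < n)%N -> smooth_on U (fun t => if b then kappa k t else 0).
  by case: b => kn; [exact: sk|exact: smooth_on_cst].
apply: smooth_onM => //; first by apply: sk; exact: leq_ltn_trans iltn.
apply: smooth_onD => //; first exact: sif.
have -> : (fun t => - (if i == j.+1 then kappa i t else 0)) =
    fun t => -1 * (if i == j.+1 then kappa i t else 0).
  by apply/funext => t; rewrite mulN1r.
by apply: smooth_onM => //; [exact: smooth_on_cst|exact: sif].
Qed.

Lemma sum_if_ord (V : lmodType R) n (a : nat) (f : nat -> R) (x : nat -> V) :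
  \sum_(j < n) (if j == a :> nat then f j else 0) *: x j =
  if (a < n)%N then f a *: x a else 0.
Proof.
have [an|na] := ltnP a n.
  rewrite (bigD1 (Ordinal an))//= eqxx big1 ?addr0// => j ja.
  case: eqP => [jE|_]; last by rewrite scale0r.
  by move: ja; rewrite -val_eqE /= jE eqxx.
rewrite big1// => j _; case: eqP => [ja|_]; last by rewrite scale0r.
by have := ltn_ord j; rewrite ja ltnNge na.
Qed.

(** A row of the matrix has at most two nonzero entries. The two guards drop the neighbours X_0 and
    X_(n+1), so that the first, middle and last Frenet equations are instances of one formula. *)
Lemma sum_frenet_coef (V : lmodType R) n kappa i t (x : nat -> V) : (i < n)%N ->
  \sum_(j < n) frenet_coef kappa i j t *: x j =
  kappa 0%N t *: ((if (i.+1 < n)%N then kappa i.+1 t *: x i.+1 else 0) -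
                  (if (0 < i)%N then kappa i t *: x i.-1 else 0)).
Proof.
move=> iltn; rewrite -(sum_if_ord n i.+1 (kappa^~ t) x).
have -> : (if (0 < i)%N then kappa i t *: x i.-1 else 0) =
    \sum_(j < n) (if i == j.+1 then kappa i t else 0) *: x j.
  case: i iltn => [|i] iltn /=; first by rewrite big1// => j _; rewrite scale0r.
  have := sum_if_ord n i (fun _ => kappa i.+1 t) x; rewrite (ltnW iltn) => <-.
  by apply: eq_bigr => j _; rewrite eqSS eq_sym.
rewrite -sumrB scaler_sumr; apply: eq_bigr => j _.
by rewrite /frenet_coef -scalerBl scalerA.
Qed.

End FrenetCoefficients.

(** * The Frenet equations as one linear system *)

Section FrenetSystem.
Context {R : realType} {m : nat} (M : smooth_manifold R m).
Variable nabla : forall x : M, 'rV[R]_m -> (M -> 'rV[R]_m) -> 'rV[R]_m.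
Variable g : M -> 'rV[R]_m -> 'rV[R]_m -> R.
Implicit Types (sigma : R -> M) (X : nat -> R -> 'rV[R]_m) (kappa : nat -> R -> R).
Implicit Types (a b t : R).

(** The division by kappa_0 is cleared, so the system is meaningful and smooth without any condition
    on signs. *)
Definition frenet_system sigma X kappa t : Prop :=
  velocity sigma t = kappa 0%N t *: X 1%N t /\
  forall i : 'I_m, covD nabla sigma (X i.+1) t =
    \sum_(j < m) frenet_coef kappa i j t *: X j.+1 t.

(** A competing solution has its own curvatures [kap], equal to [kappa] on the interval; replacing
    them there makes all solutions satisfy literally the same system. *)
Lemma frenet_apparatus_system a b sigma X kap kappa : (2 <= m)%N ->
  frenet_apparatus nabla g a b sigma X kap ->
  (forall j t, (j <= m - 1)%N -> a < t < b -> kap j t = kappa j t) ->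
  forall t, a < t < b -> frenet_system sigma X kappa t.
Proof.
move=> m2 A kk t tab; have k0 : kappa 0%N t != 0.
  by rewrite -kk// gt_eqF// (frenet_curvature_pos A).
split; first by rewrite (frenet_velocity A)// kk.
move=> i; have im := ltn_ord i; rewrite (sum_frenet_coef kappa t (fun j => X j.+1 t) im).
apply: (scalerI (invr_neq0 k0)); rewrite scalerK//.
have [i0|i0] := posnP i.
  rewrite i0 subr0 m2 -(kk 1%N) ?subn_gt0// -(kk 0%N)//.
  exact: (frenet_first A).
have [im1|im1] := ltnP i.+1 m.
  have i1 : (2 <= i.+1 <= m - 1)%N by lia.
  have := frenet_middle A i1 tab; rewrite subn1 addn1 /= => E.
  rewrite -(kk 0%N)// E addrC !kk ?prednK//; last first.
  - by case/andP: i1.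
  - by case/andP: i1 => _; exact/leq_trans/leqnSn.
  by rewrite scaleNr.
have im' : i.+1 = m by apply/eqP; rewrite eqn_leq im.
rewrite sub0r prednK// -(kk i)//; last by lia.
rewrite -(kk 0%N)//; have := frenet_last A tab.
have -> : (m - 1 = i)%N by lia.
by rewrite (congr1 X im') => ->; rewrite scaleNr.
Qed.

Lemma frenet_system_equations sigma X kappa t : (2 <= m)%N -> kappa 0%N t != 0 ->
  frenet_system sigma X kappa t ->
  [/\ (kappa 0%N t)^-1 *: covD nabla sigma (X 1%N) t = kappa 1%N t *: X 2%N t,
      forall i, (2 <= i <= m - 1)%N -> (kappa 0%N t)^-1 *: covD nabla sigma (X i) t =
        - kappa (i - 1)%N t *: X (i - 1)%N t + kappa i t *: X (i + 1)%N t &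
      (kappa 0%N t)^-1 *: covD nabla sigma (X m) t =
        - kappa (m - 1)%N t *: X (m - 1)%N t].
Proof.
move=> m2 k0 [_ S].
have {}S i : (i < m)%N -> (kappa 0%N t)^-1 *: covD nabla sigma (X i.+1) t =
    (if (i.+1 < m)%N then kappa i.+1 t *: X i.+2 t else 0) -
    (if (0 < i)%N then kappa i t *: X i.-1.+1 t else 0).
  move=> im; rewrite (S (Ordinal im)).
  by rewrite (sum_frenet_coef kappa t (fun j => X j.+1 t) im) scalerK.
split.
- by rewrite S ?(ltnW m2)// m2 ltnn subr0.
- case=> [//|i] /andP[i1 im].
  have im1 : (i.+1 < m)%N by lia.
  rewrite (S i (ltnW im1)) im1 -[(0 < i)%N]/(1 < i.+1)%N i1 subn1 addn1 /=.
  by rewrite prednK// scaleNr addrC.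
- have mE : m = m.-1.+1 by lia.
  have m1 : (m.-1 < m)%N by lia.
  have m0 : (0 < m.-1)%N by lia.
  have := S _ m1; rewrite m0 -mE ltnn sub0r => ->.
  by rewrite prednK// subn1 scaleNr.
Qed.

End FrenetSystem.

Lemma open_oo {R : realType} (a b : R) : open [set t | a < t < b].
Proof. by rewrite -set_itvoo; exact: interval_open. Qed.

Section Regularity.
Context {R : realType} {m : nat} (M : smooth_manifold R m).
Implicit Types (sigma : R -> M) (X : R -> 'rV[R]_m).

Lemma smooth_curve_regular a b sigma t :
  smooth_curve a b sigma -> a < t < b -> regular_curve sigma t.
Proof.
move=> [cs ss] tab; split; first exact: cs.
by move=> i it; apply: smooth_on_differentiable (ss i) _.
Qed.

Lemma smooth_along_regular a b sigma X t :
  smooth_along a b sigma X -> a < t < b -> regular_field sigma X t.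
Proof.
by move=> sX tab i it; apply: smooth_on_differentiable (sX i) _.
Qed.

End Regularity.

(** * Iterated derivatives of the velocity in terms of the frame *)

Section VelocityD.
Context {R : realType} {m : nat} (M : smooth_manifold R m).
Variable nabla : forall x : M, 'rV[R]_m -> (M -> 'rV[R]_m) -> 'rV[R]_m.
Variable g : M -> 'rV[R]_m -> 'rV[R]_m -> R.
Hypothesis hg : riemannian_metric g.
Hypothesis m2 : (2 <= m)%N.
Variables (a b : R) (sigma : R -> M) (X : nat -> R -> 'rV[R]_m) (kappa : nat -> R -> R).
Let I := [set t : R | a < t < b].
Hypothesis skappa : forall j, (j < m)%N -> smooth_on I (kappa j).
Hypothesis kappa_pos : forall j t, (j <= m - 2)%N -> I t -> 0 < kappa j t.
Hypothesis rX : forall (i : 'I_m) t, I t -> regular_field sigma (X i.+1) t.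
Hypothesis sys : forall t, I t -> frenet_system nabla sigma X kappa t.

(** Needed because the expansion of the iterated derivatives in the frame holds on the interval
    only, and is to be differentiated there. *)
Lemma near_eq_covD (Y Z : R -> 'rV[R]_m) t : (\near t, Y t = Z t) ->
  covD nabla sigma Y t = covD nabla sigma Z t.
Proof.
move=> YZ; rewrite !covDE; apply: eq_bigr => k _.
have YZt : Y t = Z t := nbhs_singleton YZ.
congr (_ *: _ + _); last by rewrite YZt.
by apply: near_eq_derive; apply: filterS YZ => s ->.
Qed.

(* The k-th iterated derivative of the velocity is a combination of X_1, ...,
   X_(k+1), with leading coefficient kappa_0^(k+1) kappa_1 ... kappa_k > 0. *)
Lemma velocityD_triangular k : (k <= m - 2)%N ->
  exists P : nat -> R -> R, [/\ forall l, (l < m)%N -> smooth_on I (P l),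
    forall l t, (k < l)%N -> P l t = 0, forall t, I t -> 0 < P k t &
    forall t, I t -> velocityD nabla sigma k t = \sum_(l < m) P l t *: X l.+1 t].
Proof.
have oI : open I by exact: open_oo.
have m0 : (0 < m)%N by exact: ltnW.
elim: k => [|k IH] km.
  exists (fun l t => if l == 0%N then kappa l t else 0); split.
  - by move=> l lm; case: eqP => _; [exact: skappa|exact: smooth_on_cst].
  - by move=> [|l].
  - by move=> t It; exact: kappa_pos.
  - move=> t It; have [+ _] := sys It => /= ->.
    by rewrite (sum_if_ord m 0 (kappa^~ t) (fun l => X l.+1 t)) m0.
have [|P [sP P0 Pk PE]] := IH; first exact: leq_trans km.
(* Differentiating sum P_l X_(l+1) gives P_l' plus the contribution of the Frenet matrix. *)
exists (fun l t => 'D_1 (P l) t + \sum_(j < m) P j t * frenet_coef kappa j l t).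
split.
- move=> l lm; apply: smooth_onD => //; first by apply: smooth_on_derive; exact: sP.
  apply: smooth_on_sum => // j _; apply: smooth_onM => //; first exact: sP.
  exact: (smooth_frenet_coef oI skappa (ltn_ord j) lm).
- move=> l t kl; have -> : P l = cst 0 by apply/funext => s; rewrite P0// ltnW.
  rewrite derive_cst add0r big1// => j _.
  have [kj|jk] := ltnP k j; first by rewrite P0// mul0r.
  rewrite /frenet_coef gtn_eqF ?(leq_ltn_trans _ kl)// ltn_eqF; last by lia.
  by rewrite subrr !mulr0.
(* Only the term of index k survives in the new leading coefficient, which is thus P_k kappa_0
   kappa_(k+1); the bound k + 1 <= m - 2 ensures that this curvature is positive. *)
- move=> t It; have -> : P k.+1 = cst 0 by apply/funext => s; rewrite P0.
  have kltm : (k < m)%N by lia.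
  rewrite derive_cst add0r (bigD1 (Ordinal kltm))//= big1 ?addr0; last first.
    move=> j jk; have [kj|jk'] := ltnP k j; first by rewrite P0// mul0r.
    have {}jk : (j < k)%N by rewrite ltn_neqAle jk' andbT; exact: jk.
    rewrite /frenet_coef gtn_eqF ?(leq_ltn_trans jk)// ltn_eqF; last by lia.
    by rewrite subrr !mulr0.
  rewrite /frenet_coef eqxx ltn_eqF; last by lia.
  by rewrite subr0 mulr_gt0 ?Pk// mulr_gt0// kappa_pos.
- move=> t It; have nI : \forall s \near t, I s by exact: open_nbhs_nbhs.
  have PEn : \near t, velocityD nabla sigma k t = \sum_(l < m) P l t *: X l.+1 t.
    by apply: filterS nI => s; exact: PE.
  rewrite /velocityD iterS (near_eq_covD PEn).
  rewrite (covD_lincomb nabla (F := fun l : 'I_m => P l)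
    (X := fun l : 'I_m => X l.+1)); first last.
  - by move=> l; exact: rX.
  - by move=> l; apply: smooth_on_differentiable (sP _ (ltn_ord l)) It.
  rewrite big_split /=; under [X in _ + X]eq_bigr => j _.
    rewrite (sys It).2 scaler_sumr; under eq_bigr do rewrite scalerA; over.
  rewrite exchange_big -big_split; apply: eq_bigr => l _ /=.
  by rewrite -scaler_suml -scalerDl.
Qed.

Lemma velocityD_frenet_matrix i t : (i <= m - 1)%N -> I t ->
  exists T : 'M[R]_i, 0 < \det T /\
    \matrix_(k < i) velocityD nabla sigma k t = T *m \matrix_(k < i) X k.+1 t.
Proof.
move=> im It.
have tri (k : 'I_i) : exists P : nat -> R, [/\ forall l, (k < l)%N -> P l = 0,
    0 < P k & velocityD nabla sigma k t = \sum_(l < m) P l *: X l.+1 t].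
  have [|P [_ P0 Pk PE]] := @velocityD_triangular k; first by have := ltn_ord k; lia.
  by exists (fun l => P l t); split; [move=> l; exact: P0|exact: Pk|exact: PE].
have [P hP] := choice tri.
exists (\matrix_(k, l) P k l); split.
  rewrite det_trig.
    by apply: prodr_gt0 => k _; rewrite mxE; have [] := hP k.
  by apply/is_trig_mxP => k l kl; rewrite mxE; have [P0 _ _] := hP k; exact: P0.
apply/row_matrixP => k; rewrite rowK row_mul mulmx_sum_row.
have [P0 _ ->] := hP k.
have lem : (i <= m)%N by lia.
transitivity (\sum_(l < i) P k l *: X l.+1 t); last first.
  by apply: eq_bigr => l _; rewrite rowK !mxE.
rewrite (big_ord_widen m (fun l => P k l *: X l.+1 t) lem) [RHS]big_mkcond /=.
apply: eq_bigr => l _; case: ifPn => //; rewrite -leqNgt => il.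
by rewrite P0 ?scale0r//; exact: leq_trans il.
Qed.

Lemma frenet_frame_span i t : (i <= m - 1)%N -> I t ->
  let A := \matrix_(k < i) X k.+1 t in
  let B := \matrix_(k < i) velocityD nabla sigma k t in
  (A == B)%MS /\ equally_oriented A B.
Proof.
move=> im It A B; have [T [T0 BE]] := velocityD_frenet_matrix im It.
have uT : T \in unitmx by rewrite unitmxE unitfE gt_eqF.
have AE : A = invmx T *m B by rewrite /B BE mulKmx.
split; first by apply/andP; split; [rewrite AE submxMl|rewrite /B BE submxMl].
by exists (invmx T) => //; rewrite det_inv invr_gt0.
Qed.

(** The rank is that of the first m - 1 frame vectors, which span the same subspace and are
    orthonormal. *)
Lemma frenet_frame_row_free t : I t ->
  orthonormal_basis g (sigma t) (fun k : 'I_m => X k.+1 t) ->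
  row_free (\matrix_(k < m.-1) velocityD nabla sigma k t).
Proof.
move=> It oX; have mm : (m.-1 <= m - 1)%N by lia.
have [/eqmxP AB _] := frenet_frame_span mm It.
rewrite /row_free -AB; apply: (@orthonormal_row_free _ _ _ _ hg (sigma t)) => k l.
exact: (oX (widen_ord (leq_pred m) k) (widen_ord (leq_pred m) l)).
Qed.

End VelocityD.

(** * The Frenet system in coordinates *)

Section FrenetODE.
Context {R : realType} {m : nat} (M : smooth_manifold R m).
Variable nabla : forall x : M, 'rV[R]_m -> (M -> 'rV[R]_m) -> 'rV[R]_m.
Hypothesis hnabla : affine_connection nabla.
Variables (c : chart_index M) (kappa : nat -> R -> R) (i0 : 'I_m).
Hypothesis i0E : i0 = 0%N :> nat.
Implicit Types (sigma : R -> M) (X : nat -> R -> 'rV[R]_m) (t : R).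

Let state := ('I_m + 'I_m * 'I_m)%type.

(* [inl k] is the k-th coordinate of the point of the curve and [inr (i, l)] the
   l-th component of the frame vector X_(i+1), all in the chart [c]. *)
Definition frenet_rhs (s : state) t (u : state -> R) : R :=
  match s with
  | inl k => kappa 0%N t * u (inr (i0, k))
  | inr (i, l) => \sum_(j < m) frenet_coef kappa i j t * u (inr (j, l)) +
      \sum_k \sum_a -1 * (u (inr (i, k)) * (kappa 0%N t * u (inr (i0, a)) *
        christoffel nabla c a k (chart_inv c (\row_q u (inl q))) 0 l))
  end.

Definition frenet_state sigma X (s : state) t : R :=
  match s with
  | inl k => chart c (sigma t) 0 k
  | inr (i, l) => tcomp c (sigma t) (X i.+1 t) 0 l
  end.

Lemma smooth_christoffel_coord a k l : smooth_on (chart c @` chart_dom c)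
  (fun y => christoffel nabla c a k (chart_inv c y) 0 l).
Proof.
have oc := @chart_image_open _ _ M c.
have /(smooth_on_mxP _ oc) sC := @smooth_christoffel _ _ _ _ hnabla c a k.
exact: sC.
Qed.

Lemma lip_near_frenet_rhs (U : set R) t0 (u0 : state -> R) : open U -> U t0 ->
  (forall j, (j < m)%N -> smooth_on U (kappa j)) ->
  (chart c @` chart_dom c) (\row_q u0 (inl q)) ->
  forall s, lip_near (frenet_rhs s) t0 u0.
Proof.
move=> oU Ut0 sk u0c.
have m0 : (0 < m)%N by rewrite -i0E.
case=> [k|[i l]] /=.
  by apply: lip_nearM; [exact: lip_near_time (sk _ m0)|exact: lip_near_proj].
apply: lip_nearD.
  apply: lip_near_sum => j; apply: lip_nearM; last exact: lip_near_proj.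
  have sF := smooth_frenet_coef oU sk (ltn_ord i) (ltn_ord j).
  exact: (@lip_near_time _ _ U _ t0 u0 oU Ut0 sF).
apply: lip_near_sum => k; apply: lip_near_sum => a.
apply: lip_nearM; first exact: lip_near_cst.
apply: lip_nearM; first exact: lip_near_proj.
apply: lip_nearM.
  by apply: lip_nearM; [exact: lip_near_time (sk _ m0)|exact: lip_near_proj].
have sC := @smooth_christoffel_coord a k l.
exact: (@lip_near_row _ _ _ _ _ (fun q => inl q) t0 u0 (@chart_image_open _ _ M c) u0c sC).
Qed.

(** The inductive step of the bootstrap: the right-hand side along [w] is as regular as [w]. *)
Lemma cn_on_frenet_rhs n (U : set R) (w : state -> R -> R) : open U ->
  (forall j, (j < m)%N -> smooth_on U (kappa j)) ->
  (forall t, U t -> (chart c @` chart_dom c) (\row_q w (inl q) t)) ->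
  (forall s, cn_on n U (w s)) ->
  forall s, cn_on n U (fun t => frenet_rhs s t (w^~ t)).
Proof.
move=> oU sk wc cw.
have m0 : (0 < m)%N by rewrite -i0E.
have ck : cn_on n U (kappa 0%N) by apply/(smooth_onP _ _).1; exact: sk.
case=> [k|[i l]] /=; first exact: cn_onM.
apply: cn_onD => //.
  apply: cn_on_sum => // j _; apply: cn_onM => //.
  apply/(smooth_onP _ _).1.
  exact: (smooth_frenet_coef oU sk (ltn_ord i) (ltn_ord j)).
apply: cn_on_sum => // k _; apply: cn_on_sum => // a _.
apply: cn_onM => //; first exact: cn_on_cst.
apply: cn_onM => //; apply: cn_onM => //; first exact: cn_onM.
apply: (cn_on_comp (U' := chart c @` chart_dom c)
  (f := fun t => \row_q w (inl q) t)
  (g := fun y => christoffel nabla c a k (chart_inv c y) 0 l)) => //.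
  apply/cn_on_mxP => // o q.
  have -> : (fun t => (\row_q0 w (inl q0) t) o q) = w (inl q).
    by apply/funext => t; rewrite mxE.
  exact: cw.
by apply/(smooth_onP _ _).1; exact: smooth_christoffel_coord.
Qed.

Lemma row_frenet_state sigma X t :
  \row_q frenet_state sigma X (inl q) t = chart c (sigma t).
Proof. by apply/rowP => q; rewrite mxE. Qed.

Section AtPoint.
Variables (sigma : R -> M) (X : nat -> R -> 'rV[R]_m) (t : R).
Hypothesis rs : regular_curve sigma t.
Hypothesis rX : forall i : 'I_m, regular_field sigma (X i.+1) t.
Hypothesis ct : chart_dom c (sigma t).

Let dchart k : is_derive t 1 (frenet_state sigma X (inl k))
  (tcomp c (sigma t) (velocity sigma t) 0 k).
Proof.
have dc := rs.2 c ct; rewrite (tcomp_velocity rs ct).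
rewrite (derive_coord _ 0 k dc); apply: differentiable_is_derive.
exact: (differentiable_mxP _ _).1 dc _ _.
Qed.

Lemma frenet_system_ode : frenet_system nabla sigma X kappa t ->
  forall s, is_derive t 1 (frenet_state sigma X s)
    (frenet_rhs s t ((frenet_state sigma X)^~ t)).
Proof.
move=> [vE XE]; have vcE : tcomp c (sigma t) (velocity sigma t) =
    kappa 0%N t *: tcomp c (sigma t) (X i0.+1 t) by rewrite vE tcompZ i0E.
have vc a : tcomp c (sigma t) (velocity sigma t) 0 a =
    kappa 0%N t * tcomp c (sigma t) (X i0.+1 t) 0 a by rewrite vcE mxE.
case=> [k|[i l]].
  by apply: is_derive_eq (dchart k) _; rewrite vc.
apply: is_derive_eq (regular_field_comp l (rX i) ct) _.
have := tcomp_covD hnabla l rs (rX i) ct.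
rewrite (XE i) tcomp_sum summxE => /eqP; rewrite -subr_eq => /eqP E.
apply: etrans (esym E) _; rewrite /frenet_rhs row_frenet_state chartK//.
congr (_ + _); first by apply: eq_bigr => j _; rewrite tcompZ mxE.
rewrite -sumrN; apply: eq_bigr => k _; rewrite -sumrN; apply: eq_bigr => a _.
by rewrite vc mulN1r.
Qed.

Lemma ode_frenet_system :
  (forall s, is_derive t 1 (frenet_state sigma X s)
    (frenet_rhs s t ((frenet_state sigma X)^~ t))) ->
  frenet_system nabla sigma X kappa t.
Proof.
move=> D; have vcE : tcomp c (sigma t) (velocity sigma t) =
    kappa 0%N t *: tcomp c (sigma t) (X i0.+1 t).
  apply/rowP => k; have := dchart k => -[_ <-].
  by have := D (inl k) => -[_ ->]; rewrite mxE.
have vc a : tcomp c (sigma t) (velocity sigma t) 0 a =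
    kappa 0%N t * tcomp c (sigma t) (X i0.+1 t) 0 a by rewrite vcE mxE.
split.
  by apply: (tcomp_inj ct); rewrite vcE tcompZ i0E.
move=> i; apply: (tcomp_inj ct); apply/rowP => l.
rewrite (tcomp_covD hnabla l rs (rX i) ct).
have [_ E] := D (inr (i, l)); have {}E : 'D_1 (fun s => tcomp c (sigma s) (X i.+1 s) 0 l) t =
   frenet_rhs (inr (i, l)) t ((frenet_state sigma X)^~ t) by exact: E.
rewrite E /frenet_rhs row_frenet_state chartK// -addrA [X in _ + X](_ : _ = 0); last first.
  rewrite -big_split big1// => k _ /=; rewrite -big_split big1// => a _ /=.
  by rewrite vc mulN1r addNr.
rewrite addr0 tcomp_sum summxE; apply: eq_bigr => j _.
by rewrite tcompZ mxE.
Qed.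

End AtPoint.

End FrenetODE.

(** * Existence and uniqueness *)

(** Preimages of neighbourhoods of [f x] and [g x] meet on [A], where the functions agree, so the
    two values cannot be separated. *)
Lemma closure_continuous_eq {T U : topologicalType} (f g : T -> U) (A : set T) (x : T) :
  hausdorff_space U -> {for x, continuous f} -> {for x, continuous g} ->
  closure A x -> (forall y, A y -> f y = g y) -> f x = g x.
Proof.
move=> hU cf cg clA fg; apply: hU => B C fB gC.
have fB' : nbhs x (f @^-1` B) := cf _ fB.
have gC' : nbhs x (g @^-1` C) := cg _ gC.
have [y [Ay [By Cy]]] := clA _ (filterI fB' gC').
by exists (f y); split => //; rewrite (fg _ Ay).
Qed.

(** * Curves and fields built from their coordinates in a chart *)

Section Lift.
Context {R : realType} {m : nat} (M : smooth_manifold R m).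
Variables (c : chart_index M) (a b : R) (y : R -> 'rV[R]_m).
Let I := [set t : R | a < t < b].
Hypothesis sy : smooth_on I y.
Hypothesis yc : forall t, I t -> (chart c @` chart_dom c) (y t).

(* The field along [sigma] whose components in the chart [c] are [Y]. *)
Definition lift_field (sigma : R -> M) (Y : R -> 'rV[R]_m) (t : R) : 'rV[R]_m :=
  Y t *m transition_jac c (chart_at (sigma t)) (sigma t).

Let sigma := chart_inv c \o y.

Lemma lift_dom t : I t -> chart_dom c (sigma t).
Proof. by move=> /yc[x cx xy]; rewrite /sigma /= -xy chartK. Qed.

Lemma chart_lift t : I t -> chart c (sigma t) = y t.
Proof. by move=> /yc[x cx xy]; rewrite /sigma /= -xy chartK. Qed.

Lemma lift_continuous t : I t -> {for t, continuous sigma}.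
Proof.
move=> It; apply: continuous_comp.
  by apply: differentiable_continuous; exact: smooth_on_differentiable sy It.
by apply: chart_inv_continuous; exact: yc.
Qed.

Lemma lift_open i : open [set t | a < t < b /\ chart_dom i (sigma t)].
Proof.
rewrite openE => t [It it]; apply: filterI.
  exact: open_nbhs_nbhs (conj (@open_oo _ a b) It).
exact: near_chart_dom (lift_continuous It) it.
Qed.

Lemma lift_smooth_curve : smooth_curve a b sigma.
Proof.
split=> [t It|i]; first exact: lift_continuous.
have oU := @chart_image_openI _ _ M c _ (@chart_dom_open _ _ M i).
apply: (@smooth_on_comp _ _ _ _ _ _ _ y (chart i \o chart_inv c) (@lift_open i) oU).
- by move=> t [It it]; exists (sigma t); [split=> //; exact: lift_dom|exact: chart_lift].
- by apply: smooth_on_subset sy => t [].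
- exact: transition_smooth.
Qed.

Lemma tcomp_lift_field Y t : I t -> tcomp c (sigma t) (lift_field sigma Y t) = Y t.
Proof. by move=> It; apply: tcomp_jacV; exact: lift_dom. Qed.

Lemma smooth_lift_field Y : smooth_on I Y -> smooth_along a b sigma (lift_field sigma Y).
Proof.
move=> sY i; have oV := @lift_open i.
apply: (@eq_smooth_on _ _ _ _ (fun t => Y t *m transition_jac c i (sigma t)) _ oV).
  move=> t; rewrite inE => -[It it]; have ct := lift_dom It.
  by apply: etrans (tcomp_jac _ ct it); rewrite tcomp_lift_field.
apply: (smooth_on_mulmx oV); first by apply: smooth_on_subset sY => t [].
have oU : open (chart c @` (chart_dom c `&` (chart_dom c `&` chart_dom i))).
  by apply: chart_image_openI; apply: openI; exact: chart_dom_open.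
apply: (@smooth_on_comp _ _ _ _ _ _ _ y
  (fun z => transition_jac c i (chart_inv c z)) oV oU).
- move=> t [It it]; have ct := lift_dom It.
  by exists (sigma t); [split|exact: chart_lift].
- by apply: smooth_on_subset sy => t [].
- exact: smooth_transition_jac.
Qed.

End Lift.

(** * Two solutions that agree at one instant agree on the whole interval *)

Section Uniqueness.
Context {R : realType} {m : nat} (M : smooth_manifold R m).
Variable nabla : forall x : M, 'rV[R]_m -> (M -> 'rV[R]_m) -> 'rV[R]_m.
Hypothesis hnabla : affine_connection nabla.
Variables (i0 : 'I_m) (i0E : i0 = 0%N :> nat) (a b : R) (kappa : nat -> R -> R).
Let I := [set t : R | a < t < b].
Hypothesis skappa : forall j, (j < m)%N -> smooth_on I (kappa j).

Definition frenet_solution (sigma : R -> M) (X : nat -> R -> 'rV[R]_m) : Prop :=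
  forall t, I t -> [/\ regular_curve sigma t,
    forall i : 'I_m, regular_field sigma (X i.+1) t &
    frenet_system nabla sigma X kappa t].

Variables (sigma sigma' : R -> M) (X X' : nat -> R -> 'rV[R]_m).
Hypothesis sol : frenet_solution sigma X.
Hypothesis sol' : frenet_solution sigma' X'.

Let agree := [set t | I t /\ sigma t = sigma' t /\
  forall i : 'I_m, X i.+1 t = X' i.+1 t].

Lemma open_agree : open agree.
Proof.
have oI : open I by exact: open_oo.
rewrite openE => t [It [st Xt]]; set c := chart_at (sigma t).
have ct : chart_dom c (sigma t) by exact: chart_at_dom.
have ct' : chart_dom c (sigma' t) by rewrite -st.
have [rs _ _] := sol It; have [rs' _ _] := sol' It.
have nI : \forall s \near t, I s by exact: open_nbhs_nbhs.
have nc := near_chart_dom rs.1 ct; have nc' := near_chart_dom rs'.1 ct'.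
have lip s : lip_near (frenet_rhs nabla c kappa i0 s) t
    ((frenet_state c sigma X)^~ t).
  apply: (lip_near_frenet_rhs hnabla i0E oI It skappa).
  by rewrite row_frenet_state; exists (sigma t).
have E0 s : frenet_state c sigma' X' s t = frenet_state c sigma X s t.
  by case: s => [k|[i l]] /=; rewrite -st ?Xt.
have dX : \forall s \near t, forall q, is_derive (s : R) 1 (frenet_state c sigma X q)
    (frenet_rhs nabla c kappa i0 q s ((frenet_state c sigma X)^~ s)).
  near=> s; have Is : I s by near: s.
  have cs : chart_dom c (sigma s) by near: s.
  by have [rs_ rX_ sys_] := sol Is; exact: frenet_system_ode.
have dX' : \forall s \near t, forall q, is_derive (s : R) 1 (frenet_state c sigma' X' q)
    (frenet_rhs nabla c kappa i0 q s ((frenet_state c sigma' X')^~ s)).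
  near=> s; have Is : I s by near: s.
  have cs : chart_dom c (sigma' s) by near: s.
  by have [rs_ rX_ sys_] := sol' Is; exact: frenet_system_ode.
have E := ode_local_uniqueness lip (fun=> erefl) E0 dX dX'.
near=> s; have Is : I s by near: s.
have cs : chart_dom c (sigma s) by near: s.
have cs' : chart_dom c (sigma' s) by near: s.
have Es : forall q, frenet_state c sigma X q s = frenet_state c sigma' X' q s by near: s.
have sE : sigma s = sigma' s.
  rewrite -(chartK cs) -(chartK cs'); congr (chart_inv c _).
  by apply/rowP => k; exact: (Es (inl k)).
split => //; split => // i; apply: (tcomp_inj cs); apply/rowP => l.
by have := Es (inr (i, l)); rewrite /frenet_state -sE.
Unshelve. all: by end_near. Qed.

Lemma closed_agree t : I t -> closure agree t -> agree t.
Proof.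
move=> It clt; have [rs rX _] := sol It; have [rs' rX' _] := sol' It.
have st : sigma t = sigma' t.
  apply: closure_continuous_eq (@mhausdorff _ _ M) rs.1 rs'.1 clt _.
  by move=> s [_ []].
(* Continuity is available for the components in the fixed chart [c], not for [X] itself, whose
   reference chart moves with the point. *)
split => //; split => // i; set c := chart_at (sigma t).
have ct : chart_dom c (sigma t) by exact: chart_at_dom.
have ct' : chart_dom c (sigma' t) by rewrite -st.
apply: (tcomp_inj ct); rewrite [in RHS]st.
have cX := differentiable_continuous (rX i c ct).
have cX' := differentiable_continuous (rX' i c ct').
apply: (closure_continuous_eq (@norm_hausdorff _ _) cX cX' clt).
by move=> s [_ [-> ->]].
Qed.

Lemma frenet_solution_unique t0 : I t0 -> sigma t0 = sigma' t0 ->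
  (forall i : 'I_m, X i.+1 t0 = X' i.+1 t0) -> forall t, I t -> sigma t = sigma' t.
Proof.
move=> It0 s0 X0 t It.
have cI : connected I.
  by rewrite /I -set_itvoo; apply/connected_intervalP; exact: interval_is_interval.
suff AE : agree = I by have : agree t by [rewrite AE]; case=> _ [].
apply: cI.
- by exists t0.
- exists agree; first exact: open_agree.
  by apply/seteqP; split=> [s As|s []//]; split => //; case: As.
- exists (closure agree); first exact: closed_closure.
  apply/seteqP; split=> [s As|s [Is cs]]; last exact: closed_agree.
  by split; [case: As|exact: subset_closure].
Qed.

End Uniqueness.

(** * Existence and smoothness of local solutions *)

Section LocalExistence.
Context {R : realType} {m : nat} (M : smooth_manifold R m).
Variable nabla : forall x : M, 'rV[R]_m -> (M -> 'rV[R]_m) -> 'rV[R]_m.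
Hypothesis hnabla : affine_connection nabla.
Variables (i0 : 'I_m) (i0E : i0 = 0%N :> nat).

Lemma ode_solution_smooth c (kappa : nat -> R -> R) (U : set R)
    (w : 'I_m + 'I_m * 'I_m -> R -> R) : open U ->
  (forall j, (j < m)%N -> smooth_on U (kappa j)) ->
  (forall t, U t -> (chart c @` chart_dom c) (\row_q w (inl q) t)) ->
  (forall s t, U t -> is_derive t 1 (w s) (frenet_rhs nabla c kappa i0 s t (w^~ t))) ->
  forall s, smooth_on U (w s).
Proof.
move=> oU sk wc dw s; apply/smooth_onP => n; elim: n s => [|n IH] s.
  by split => // t Ut; apply: is_derive_differentiable (dw s t Ut).
have df t : U t -> differentiable (w s) t.
  by move=> Ut; apply: is_derive_differentiable (dw s t Ut).
(* The derivative of [w s] along [v] is [v] times the right-hand side, which has order [n] by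
   induction; so [w s] gains one order. *)
split => // v.
apply: (@eq_cn_on _ _ _ _ _
  (fun t => v * frenet_rhs nabla c kappa i0 s t (w^~ t))) => //.
  move=> t; rewrite inE => Ut; have [_ <-] := dw s t Ut.
  have dft := df t Ut.
  by rewrite !deriveE// diff1E//= scale1r.
apply: cn_onM => //; first exact: cn_on_cst.
exact: (cn_on_frenet_rhs hnabla i0E oU sk wc IH).
Qed.

Lemma frenet_local_solution (x0 : M) (v : nat -> 'rV[R]_m) (t0 delta : R)
    (kappa : nat -> R -> R) : 0 < delta ->
  (forall j, (j < m)%N -> smooth_on [set t | t0 - delta < t < t0 + delta] (kappa j)) ->
  let c := chart_at x0 in
  exists (h : R) (y : R -> 'rV[R]_m) (Y : nat -> R -> 'rV[R]_m),
  let I := [set t | t0 - h < t < t0 + h] in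
  let sigma := chart_inv c \o y in
  [/\ 0 < h <= delta /\ smooth_on I y,
      forall t, I t -> (chart c @` chart_dom c) (y t),
      forall j, smooth_on I (Y j),
      sigma t0 = x0 /\ forall i : 'I_m, Y i.+1 t0 = v i.+1 &
      forall t, I t ->
        frenet_system nabla sigma (fun j => lift_field c sigma (Y j)) kappa t].
Proof.
move=> d0 sk c; set D := [set t | t0 - delta < t < t0 + delta] in sk *.
have cx : chart_dom c x0 by exact: chart_at_dom.
(* The chart [c] is the preferred one at [x0], so the components of the given vectors are used
   without a Jacobian. *)
pose u0 (s : 'I_m + 'I_m * 'I_m) : R :=
  match s with inl k => chart c x0 0 k | inr (i, l) => v i.+1 0 l end.
have rowu0 : \row_q u0 (inl q) = chart c x0 by apply/rowP => q; rewrite mxE.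
have oD : open D by exact: open_oo.
have Dt0 : D t0 by rewrite /D /=; lra.
have lip s : lip_near (frenet_rhs nabla c kappa i0 s) t0 u0.
  by apply: (lip_near_frenet_rhs hnabla i0E oD Dt0 sk); rewrite rowu0; exists x0.
have [h1 h1p [w w0 dw]] := ode_existence lip.
pose y t := \row_q w (inl q) t.
have y0 : y t0 = chart c x0 by rewrite -rowu0; apply/rowP => q; rewrite !mxE w0.
have oc := @chart_image_open _ _ M c.
have t0h1 : `|t0 - t0| <= h1 by rewrite subrr normr0 ltW.
have cy : {for t0, continuous y}.
  apply: differentiable_continuous; apply/differentiable_mxP => o q.
  have -> : (fun t => y t o q) = w (inl q) by apply/funext => t; rewrite mxE.
  exact: is_derive_differentiable (dw t0 t0h1 (inl q)).
have [h2 h2p hc] : exists2 h : R, 0 < h &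
    forall t, `|t - t0| <= h -> (chart c @` chart_dom c) (y t).
  apply: near_closed_ball; apply: cy; apply: open_nbhs_nbhs; split => //.
  by rewrite y0; exists x0.
(* The three bounds are the domain of the curvatures, that of the solution, and the time during
   which it stays in the image of the chart. *)
pose h := Num.min delta (Num.min h1 h2).
have [hd hh1 hh2] : [/\ h <= delta, h <= h1 & h <= h2].
  by split; rewrite /h !ge_min lexx ?orbT.
have hp : 0 < h by rewrite !lt_min d0 h1p h2p.
set I := [set t | t0 - h < t < t0 + h].
have oI : open I by exact: open_oo.
have Ih t : I t -> `|t - t0| <= h.
  by rewrite /I /= ler_norml => /andP[? ?]; apply/andP; split; lra.
have ID : I `<=` D.
  by rewrite /I /D => t /= /andP[? ?]; apply/andP; split; lra.
have skI j : (j < m)%N -> smooth_on I (kappa j).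
  by move=> jm; apply: smooth_on_subset ID (sk j jm).
have yc t : I t -> (chart c @` chart_dom c) (y t).
  by move=> It; apply: hc; exact: le_trans (Ih t It) hh2.
have dwI s t : I t -> is_derive t 1 (w s) (frenet_rhs nabla c kappa i0 s t (w^~ t)).
  by move=> It; apply: dw; exact: le_trans (Ih t It) hh1.
have sw := ode_solution_smooth oI skI yc dwI.
have sy : smooth_on I y.
  apply/(smooth_on_mxP _ oI) => o q.
  have -> : (fun t => y t o q) = w (inl q) by apply/funext => t; rewrite mxE.
  exact: sw.
(* Fields are numbered from 1 and ordinals from 0; beyond [m] the field is 0. *)
pose Y (j : nat) t : 'rV[R]_m :=
  if insub j.-1 is Some i then \row_l w (inr (i, l)) t else 0.
have YE (i : 'I_m) t : Y i.+1 t = \row_l w (inr (i, l)) t by rewrite /Y /= valK.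
have sY j : smooth_on I (Y j).
  rewrite /Y; case: (insub _) => [i|]; last exact: smooth_on_cst.
  apply/(smooth_on_mxP _ oI) => o q.
  have -> : (fun t => (\row_l w (inr (i, l)) t) o q) = w (inr (i, q)).
    by apply/funext => t; rewrite mxE.
  exact: sw.
exists h, y, Y; split => //.
- by rewrite hp hd.
- split; first by rewrite /= y0 chartK.
  by move=> i; rewrite YE; apply/rowP => l; rewrite mxE w0.
set sigma := chart_inv c \o y; pose X j := lift_field c sigma (Y j).
move=> t It.
have rs : regular_curve sigma t.
  exact: smooth_curve_regular (lift_smooth_curve sy yc) It.
have rX (i : 'I_m) : regular_field sigma (X i.+1) t.
  exact: smooth_along_regular (smooth_lift_field sy yc (sY i.+1)) It.
have stE s t' : I t' -> frenet_state c sigma X s t' = w s t'.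
  move=> It'; case: s => [k|[i l]].
    by rewrite [LHS](congr1 (fun N : 'rV_m => N 0 k) (chart_lift yc It')) mxE.
  rewrite [LHS](congr1 (fun N : 'rV_m => N 0 l) (tcomp_lift_field yc (Y i.+1) It')).
  by rewrite YE mxE.
apply: (ode_frenet_system hnabla i0E rs rX (lift_dom yc It)) => s.
have nI : \forall t' \near t, I t' by exact: open_nbhs_nbhs.
have wst : \near t, w s t = frenet_state c sigma X s t.
  by apply: filterS nI => t' It'; exact: esym (stE s t' It').
have rhsE : frenet_rhs nabla c kappa i0 s t (w^~ t) =
    frenet_rhs nabla c kappa i0 s t ((frenet_state c sigma X)^~ t).
  congr (frenet_rhs nabla c kappa i0 s t _); apply/funext => q; exact: esym (stE q t It).
exact: near_eq_is_derive wst (is_derive_eq (dwI s t It) rhsE).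
Qed.

End LocalExistence.

Unset Implicit Arguments.

(** * Existence and uniqueness of the curve with prescribed curvatures *)

Theorem theorem3p6 (R : realType) (m : nat) (hm : (2 <= m)%N)
  (M : smooth_manifold R m) (hM : oriented_atlas M)
  (g : M -> 'rV[R]_m -> 'rV[R]_m -> R) (hg : riemannian_metric g)
  (nabla : forall x : M, 'rV[R]_m -> (M -> 'rV[R]_m) -> 'rV[R]_m)
  (hnabla : levi_civita g nabla)
  (x0 : M) (v : nat -> 'rV[R]_m)
  (hv : orthonormal_basis g x0 (fun k : 'I_m => v k.+1))
  (hv_pos : pos_oriented x0 (fun k : 'I_m => v k.+1))
  (t0 delta : R) (hdelta : 0 < delta)
  (kappa : nat -> R -> R)
  (hkappa : forall j, (j <= m - 1)%N ->
     smooth_on [set t | t0 - delta < t < t0 + delta] (kappa j))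
  (hkappa_pos : forall j t, (j <= m - 2)%N -> t0 - delta < t < t0 + delta ->
     0 < kappa j t) :
  exists2 eps : R, 0 < eps <= delta &
    let a := t0 - eps in
    let b := t0 + eps in
    let solution (sigma : R -> M) :=
      [/\ frenet_curve nabla a b sigma,
          sigma t0 = x0 &
          exists X kap, [/\ frenet_apparatus nabla g a b sigma X kap,
            forall j, (1 <= j <= m)%N -> X j t0 = v j &
            forall j t, (j <= m - 1)%N -> a < t < b -> kap j t = kappa j t]] in
    exists2 sigma : R -> M, solution sigma &
      forall sigma', solution sigma' ->
        forall t, a < t < b -> sigma' t = sigma t.
Proof.
have m0 : (0 < m)%N by exact: ltnW.
pose i0 : 'I_m := Ordinal m0; have i0E : i0 = 0%N :> nat by [].
have hc := levi_civita_connection hnabla.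
have jm j : (j < m)%N -> (j <= m - 1)%N by lia.
have mj j : (j <= m - 1)%N -> (j < m)%N by lia.
have sk j : (j < m)%N -> smooth_on [set t | t0 - delta < t < t0 + delta] (kappa j).
  by move=> /jm; exact: hkappa.
have [h [y [Y [[/andP[h0 hd] sy] yc sY [s0 Y0] sys]]]] :=
  frenet_local_solution hc i0E x0 v hdelta sk.
set c := chart_at x0 in sy yc s0 sys.
set sigma := chart_inv c \o y in s0 sys.
pose X j := lift_field c sigma (Y j).
set I := [set t | t0 - h < t < t0 + h] in sy yc sY sys.
have oI : open I by exact: open_oo.
have It0 : I t0 by rewrite /I /=; lra.
have ID t : I t -> t0 - delta < t < t0 + delta.
  by rewrite /I /= => /andP[? ?]; apply/andP; split; lra.
have skI j : (j < m)%N -> smooth_on I (kappa j).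
  by move=> /sk; apply: smooth_on_subset => t; exact: ID.
have rs t : I t -> regular_curve sigma t.
  exact: smooth_curve_regular (lift_smooth_curve sy yc).
have rX (i : 'I_m) t : I t -> regular_field sigma (X i.+1) t.
  exact: smooth_along_regular (smooth_lift_field sy yc (sY i.+1)).
have X0 (i : 'I_m) : X i.+1 t0 = v i.+1.
  have := tcomp_lift_field yc (Y i.+1) It0; rewrite Y0 -/sigma s0.
  by rewrite -/(X i.+1) tcomp_chart_at.
have on : \forall t \near t0, forall i j : 'I_m,
    g (sigma t) (X i.+1 t) (X j.+1 t) = (i == j)%:R.
  apply: (orthonormal_near hg hnabla oI It0
    (fun i j : 'I_m => smooth_frenet_coef oI skI (ltn_ord i) (ltn_ord j))) => //.
  - by move=> i j t; exact: frenet_coef_skew.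
  - by move=> i t It; exact: (sys t It).2.
  - by move=> i j; rewrite !X0 s0; exact: hv.
(* Orientation is tested in the fixed chart [c], where the determinant is a smooth function of t. *)
pose Ymx t := \matrix_(k < m) Y k.+1 t.
have sYmx : smooth_on I Ymx.
  apply/(smooth_on_mxP _ oI) => k l.
  have -> : (fun t => Ymx t k l) = fun t => Y k.+1 t 0 l.
    by apply/funext => t; rewrite mxE.
  exact: (smooth_on_mxP _ oI).1 (sY k.+1) 0 l.
have detY : \forall t \near t0, 0 < \det (Ymx t).
  have cd : {for t0, continuous (fun t => \det (Ymx t))}.
    apply: differentiable_continuous.
    exact: smooth_on_differentiable (smooth_on_det oI sYmx) It0.
  have d0 : 0 < \det (Ymx t0).
    rewrite (_ : Ymx t0 = \matrix_(k < m) v k.+1)//.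
    by apply/row_matrixP => k; rewrite !rowK Y0.
  by have /cvgr_gt/(_ _ d0) := cd.
have [e e0 he] : exists2 e : R, 0 < e & forall t, `|t - t0| <= e ->
    (forall i j : 'I_m, g (sigma t) (X i.+1 t) (X j.+1 t) = (i == j)%:R) /\
    0 < \det (Ymx t).
  by apply: near_closed_ball; near=> t; split; near: t.
(* Up to [h] the Frenet system holds; up to [e] the frame is moreover orthonormal and positively
   oriented. *)
pose eps := Num.min h e.
have [eh ee] : eps <= h /\ eps <= e by split; rewrite /eps !ge_min lexx ?orbT.
have eps0 : 0 < eps by rewrite lt_min h0 e0.
exists eps; first by rewrite eps0 (le_trans eh hd).
move=> a b solution.
have JI : [set t | a < t < b] `<=` I.
  by rewrite /I /a /b => t /= /andP[? ?]; apply/andP; split; lra.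
have Jt0 : a < t0 < b by rewrite /a /b; apply/andP; split; lra.
have skJ j : (j < m)%N -> smooth_on [set t | a < t < b] (kappa j).
  by move=> /skI; apply: smooth_on_subset.
have kpos j t : (j <= m - 2)%N -> a < t < b -> 0 < kappa j t.
  by move=> jm2 /JI/ID; exact: hkappa_pos.
have rsJ t : a < t < b -> regular_curve sigma t by move/JI; exact: rs.
have rXJ (i : 'I_m) t : a < t < b -> regular_field sigma (X i.+1) t.
  by move/JI; exact: rX.
have sysJ t : a < t < b -> frenet_system nabla sigma X kappa t.
  by move/JI; exact: sys.
have heJ t : a < t < b -> (forall i j : 'I_m,
    g (sigma t) (X i.+1 t) (X j.+1 t) = (i == j)%:R) /\ 0 < \det (Ymx t).
  rewrite /a /b => /andP[? ?]; apply: he.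
  by rewrite ler_norml; apply/andP; split; lra.
have oX t : a < t < b -> orthonormal_basis g (sigma t) (fun k : 'I_m => X k.+1 t).
  by move=> /heJ[].
have pX t : a < t < b -> pos_oriented (sigma t) (fun k : 'I_m => X k.+1 t).
  move=> tab; have [_ dY] := heJ t tab; have It := JI _ tab.
  have XE : \matrix_(k < m) X k.+1 t =
      Ymx t *m transition_jac c (chart_at (sigma t)) (sigma t).
    by apply/row_matrixP => k; rewrite row_mul !rowK.
  (* Passing to the preferred chart at the moving point multiplies by a Jacobian determinant,
     positive since the atlas is oriented. *)
  rewrite /pos_oriented XE det_mulmx mulr_gt0//.
  by apply: hM; [exact: (lift_dom yc It)|exact: chart_at_dom].
have sc : smooth_curve a b sigma.
  have [cs ss] := lift_smooth_curve sy yc; split=> [t tab|i]; first exact/cs/JI.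
  by apply: smooth_on_subset (ss i) => t [tab it]; split => //; exact: JI.
have k0 t : a < t < b -> kappa 0%N t != 0.
  by move=> tab; rewrite gt_eqF// kpos.
have eqs t tab := frenet_system_equations hm (k0 t tab) (sysJ t tab).
exists sigma.
  split => //.
    split => // t tab.
    exact: (frenet_frame_row_free (X := X) hg hm skJ kpos rXJ sysJ tab (oX t tab)).
  exists X, kappa; split => //; last first.
    case=> // j /andP[_ jm']; exact: (X0 (Ordinal jm')).
  split.
  - move=> j _ i.
    have sX := smooth_lift_field sy yc (sY j).
    apply: smooth_on_subset (sX i) => t [tab it].
    by split => //; exact: JI.
  - by move=> j /mj; exact: skJ.
  - by move=> j t; exact: kpos.
  - by move=> t tab; split; [exact: oX|exact: pX].
  - move=> i t /andP[_ im] tab.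
    exact: (frenet_frame_span (X := X) hm skJ kpos rXJ sysJ im tab).
  - by move=> t tab; have [] := sysJ t tab.
  - by move=> t tab; have [] := eqs t tab.
  - by move=> i t im tab; have [_ + _] := eqs t tab; exact.
  - by move=> t tab; have [] := eqs t tab.
(* Any other solution satisfies the same system with the same initial frame, and both are defined on
   the same interval. *)
move=> sigma' [[sc' _] s0' [X' [kap [A X'0 kapE]]]] t tab.
apply/esym.
apply: (@frenet_solution_unique _ _ _ _ hc i0 i0E a b kappa skJ sigma sigma' X X'
  _ _ t0 Jt0 _ _ t tab).
- by move=> s sab; split; [exact: rsJ|move=> i; exact: rXJ|exact: sysJ].
- move=> s sab; split; first exact: smooth_curve_regular sc' sab.
    move=> i; apply: smooth_along_regular (frenet_frame_smooth A _) sab.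
    by rewrite /= ltn_ord.
  exact: (frenet_apparatus_system hm A kapE sab).
- by rewrite s0 s0'.
- by move=> i; rewrite X0 X'0//= ltn_ord.
Unshelve. all: by end_near. Qed.
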